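(* Let $-\infty<\omega_*<\omega^*<+\infty$ and $T\in(0,+\infty)$, and consider the control system $$\dot Z(t,\omega)=i\omega Z(t,\omega)-w(t),\qquad Z(0,\omega)=Z_0(\omega),\qquad \omega\in(\omega_*,\omega^* ).\qquad(\ast)$$ The reachable set in time $T$ from $Z_0=0$ for $(\ast)$ with controls $w\in L^1(0,T)$ is $$\{Z(T);\ w\in L^1(0,T)\}=\mathcal{F}[L^1(-T,0)].$$ The set of initial conditions $Z_0$ that are asymptotically zero controllable with controls $w\in L^1(0,+\infty)$ for $(\ast)$ is $\mathcal{F}[L^1(0,+\infty)]$. For every $Z_0\in\mathcal{F}[L^1(0,+\infty)]$, the function $w:=\mathcal{F}^{-1}[Z_0]$ is the unique control in $L^1(0,+\infty)$ that steers the control system $(\ast)$ from $Z_0$ to $0$ (asymptotically as $t\to+\infty$).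
   Context: Functions are complex-valued. $\mathcal{F}(w)(\omega)=\int_{\mathbb{R}}w(t)e^{-i\omega t}dt$; a function defined on $I\subset\mathbb{R}$ is extended by $0$ to $\mathbb{R}\setminus I$. The sets $\mathcal{F}[L^1(-T,0)]$ and $\mathcal{F}[L^1(0,+\infty)]$ are understood as sets of functions of $\omega\in(\omega_*,\omega^* )$ (restrictions of Fourier transforms), and $\mathcal{F}^{-1}[Z_0]$ denotes the element $w\in L^1(0,+\infty)$ with $\mathcal{F}(w)=Z_0$ on $(\omega_*,\omega^* )$. The solution of $(\ast)$ is $Z(t,\omega)=\big(Z_0(\omega)-\int_0^t w(\tau)e^{-i\omega\tau}d\tau\big)e^{i\omega t}$. An initial condition $Z_0$ is asymptotically zero controllable if some control $w\in L^1(0,+\infty)$ steers it to $0$, i.e. the corresponding solution satisfies $Z(t,\cdot)\to0$ as $t\to+\infty$ (uniformly on $(\omega_*,\omega^* )$). *)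

(* Defs.v *)
From HB Require Import structures.
From mathcomp Require Import all_boot all_order all_algebra.
From mathcomp Require Import complex.
From mathcomp Require Import all_classical all_reals all_analysis.

Set Implicit Arguments.
Unset Strict Implicit.
Unset Printing Implicit Defensive.

Import Order.TTheory GRing.Theory Num.Theory.
Import numFieldNormedType.Exports.

Local Open Scope classical_set_scope.
Local Open Scope ring_scope.
Local Open Scope complex_scope.

Section ComplexLebesgue.
Context {R : realType}.
Implicit Types (I : set R) (w : R -> R[i]).

Definition cintegrable I w : Prop :=
  lebesgue_measure.-integrable I (EFin \o (fun t => complex.Re (w t))) /\
  lebesgue_measure.-integrable I (EFin \o (fun t => complex.Im (w t))).

Definition cintegral I w : R[i] :=
  (\int[lebesgue_measure]_(t in I) complex.Re (w t)) +i*
  (\int[lebesgue_measure]_(t in I) complex.Im (w t)).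

(* An element of L^1(I) is represented by any function R -> R[i] integrable on
   I, whose values outside I are irrelevant; two representatives are identified
   when they satisfy [ae_eq_on I]. *)
Definition L1 I : set (R -> R[i]) := [set w | cintegrable I w].

Definition ae_eq_on I w1 w2 : Prop :=
  {ae lebesgue_measure, forall t, I t -> w1 t = w2 t}.

(* [w] is, as an element of L^1(I), the only one with the property [P]. *)
Definition unique_L1 I (P : (R -> R[i]) -> Prop) w : Prop :=
  [/\ L1 I w, P w & forall w', L1 I w' -> P w' -> ae_eq_on I w' w].

Definition expi (x : R) : R[i] := cos x +i* sin x.

Definition fourier w (omega : R) : R[i] :=
  cintegral setT (fun t => w t * expi (- (omega * t))).

Definition extend0 I w : R -> R[i] := patch (fun=> 0) I w.

End ComplexLebesgue.

Section ControlSystem.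
Context {R : realType} (omega_lo omega_hi : R).

Definition band : Type := set_type `]omega_lo, omega_hi[%classic.

Implicit Types (I J : set R) (w : R -> R[i]).

Definition fourier_band I w : band -> R[i] :=
  fun omega => fourier (extend0 I w) (val omega).

Definition fourier_L1 I : set (band -> R[i]) := fourier_band I @` L1 I.

(* Caratheodory solution on the time interval [J], with left endpoint 0, of
     dZ/dt (t, omega) = i omega Z (t, omega) - w t,   Z (0, omega) = Z0 omega.
   The controls being merely integrable, this is the integrated equation; it
   entails that Z (., omega) is absolutely continuous on compact subintervals
   of [J] and satisfies the differential equation almost everywhere. *)
Definition is_solution J w (Z0 : band -> R[i]) (Z : R -> band -> R[i]) : Prop :=
  forall (omega : band) (t : R), J t ->
    let rhs := fun s => (0 +i* val omega) * Z s omega - w s in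
    cintegrable `]0, t[ rhs /\ Z t omega = Z0 omega + cintegral `]0, t[ rhs.

Definition reachable_from0 (T : R) : set (band -> R[i]) :=
  [set ZT | exists w, L1 `]0, T[ w /\
     exists Z, is_solution `[0, T] w (fun=> 0) Z /\ Z T = ZT].

Definition uniform_cvg0 (Z : R -> band -> R[i]) : Prop :=
  forall eps : R, 0 < eps ->
    \forall t \near +oo%R, forall omega : band, `|Z t omega| < eps%:C.

Definition steers_to0 w (Z0 : band -> R[i]) : Prop :=
  exists Z, is_solution `[0, +oo[ w Z0 Z /\ uniform_cvg0 Z.

Definition asymptotically_zero_controllable : set (band -> R[i]) :=
  [set Z0 | exists w, L1 `]0, +oo[ w /\ steers_to0 w Z0].

End ControlSystem.

Arguments reachable_from0 {R} omega_lo omega_hi T.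
Arguments asymptotically_zero_controllable {R} omega_lo omega_hi.
Arguments fourier_L1 {R} omega_lo omega_hi I.

(* Main.v *)
Require Import Defs.
From HB Require Import structures.
From mathcomp Require Import all_boot all_order all_algebra.
From mathcomp Require Import complex.
From mathcomp Require Import all_classical all_reals all_analysis.
From mathcomp Require Import measurable_realfun ring lra.

(** Write [E_a t = exp (- i a t)].  A solution of the controlled equation is
    determined by the variation-of-constants formula
    [Z t = exp (i omega t) (Z0 - int_0^t w E_omega)], called [duhamel] below
    ([is_solutionP]).  Controls being merely integrable, both directions rest on
    integration by parts for a primitive of an integrable function, which is
    Fubini on a triangle ([by_parts_primitive]).  The formula settles the first
    two claims: at time [T] from [Z0 = 0] it is the transform of the control
    shifted to [(-T, 0)] ([duhamel_fourier]); and since [exp (i omega t)] has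
    modulus 1 while [int_t^oo |w|] tends to 0, [Z t] tends to 0 iff [Z0] is the
    transform of [w] on the band ([steers_to0P]).

    What remains is uniqueness: a function of [L^1(0, +oo)] whose transform
    vanishes on an interval vanishes almost everywhere ([fourier_band_inj]).
    Classically this is boundary uniqueness for a function holomorphic in a half
    plane.  The proof given here is real and elementary.  After modulation the
    interval is [(- delta, delta)], and one works with a real integrable [u], the
    functional [f |-> int_0^oo u f], and its kernel, which is closed under
    bounded pointwise limits and contains the [cos (a t)] and [sin (a t)] with
    [|a| < delta].  The kernel is enlarged three times.

    - [exp (- s t)] for small [s > 0] ([gap_laplace0]).  The Gaussian of width
      [k] is the limit of [cos (x / (k m)) ^ (m ^ 2)], that is, an average of
      cosines whose frequencies follow the position of a random walk; the
      frequencies outside the gap carry a mass [O (exp (- c k ^ 2))].  Centred at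
      [- s k ^ 2] and rescaled by the large factor [exp (s ^ 2 k ^ 2 / 2)], it
      becomes [exp (- s t - t ^ 2 / 2 k ^ 2)], bounded uniformly in [k] on the
      half line only; for [s] small the gap wins, and [k] goes to infinity.
    - [exp (- B t)] for all [B >= 0] ([laplace0_extend]).  With
      [exp (- h t) = cos phi], [exp (- m h t)] is the average of the Chebyshev
      polynomials [cos (j phi)] over the walk of length [m].  Those of low degree
      are in the kernel, and the others again carry little mass.
    - Indicators of half lines ([laplace0_tail]), as limits of
      [exp (- n exp (n (c - t)))], a convergent series in the [exp (- n k t)].

    Hence the primitive of [u] vanishes, and so does [u] almost everywhere, by
    Lebesgue's differentiation theorem ([laplace0_ae0]).  The first two
    steps share the tail estimate [walk_moment_le]. *)

Set Implicit Arguments.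
Unset Strict Implicit.
Unset Printing Implicit Defensive.

Import Order.TTheory GRing.Theory Num.Theory.
Import numFieldNormedType.Exports.

Local Open Scope classical_set_scope.
Local Open Scope ring_scope.

(** * Bounded multipliers of an integrable function *)

Lemma measurable_cos {R : realType} (D : set R) : measurable_fun D (@cos R).
Proof.
by apply: measurable_funTS; apply: continuous_measurable_fun; exact: continuous_cos.
Qed.

Lemma measurable_sin {R : realType} (D : set R) : measurable_fun D (@sin R).
Proof.
by apply: measurable_funTS; apply: continuous_measurable_fun; exact: continuous_sin.
Qed.

Section BoundedMultipliers.
Context d (T : measurableType d) (R : realType).
Context (mu : {measure set T -> \bar R}) (D : set T) (mD : measurable D).
Implicit Types u f : T -> R.

Lemma integrableZl_EFin f (C : R) : mu.-integrable D (EFin \o f) ->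
  mu.-integrable D (EFin \o (fun x => C * f x)).
Proof. by move=> h; exact: (integrableZl mD C h). Qed.

Lemma integrableD_EFin u f : mu.-integrable D (EFin \o u) ->
  mu.-integrable D (EFin \o f) ->
  mu.-integrable D (EFin \o (fun x => u x + f x)).
Proof. by move=> hu hf; exact: (integrableD mD hu hf). Qed.

Lemma integrableB_EFin u f : mu.-integrable D (EFin \o u) ->
  mu.-integrable D (EFin \o f) ->
  mu.-integrable D (EFin \o (fun x => u x - f x)).
Proof. by move=> hu hf; exact: (integrableB mD hu hf). Qed.

Lemma integrableM_bounded u f (C : R) :
  mu.-integrable D (EFin \o u) -> measurable_fun D f ->
  (forall x, D x -> `|f x| <= C) ->
  mu.-integrable D (EFin \o (fun x => u x * f x)).
Proof.
move=> iu mf fC.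
have := integrableMl mD iu mf; apply.
exists C; split; first by rewrite num_real.
by move=> M CM x /= Dx; exact: le_trans (fC _ Dx) (ltW CM).
Qed.

Lemma le_normr_RintegralM u f (C : R) :
  mu.-integrable D (EFin \o u) -> measurable_fun D f ->
  (forall x, D x -> `|f x| <= C) ->
  `|\int[mu]_(x in D) (u x * f x)| <= C * \int[mu]_(x in D) `|u x|.
Proof.
move=> iu mf fC; have iuf := integrableM_bounded iu mf fC.
rewrite (le_trans (le_normr_Rintegral _ iuf))//.
rewrite -RintegralZl//; last exact: integrable_norm.
apply: le_Rintegral => //; first exact: integrable_norm.
  by apply: integrableZl_EFin; exact: integrable_norm.
by move=> x Dx; rewrite normrM mulrC ler_wpM2r ?fC.
Qed.

(** This is what makes the kernel of [f |-> \int u f] closed under bounded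
    pointwise limits. *)
Lemma cvg_RintegralM u (f_ : nat -> T -> R) f (C : R) :
  mu.-integrable D (EFin \o u) ->
  (forall n, measurable_fun D (f_ n)) ->
  (forall n x, D x -> `|f_ n x| <= C) ->
  (forall x, D x -> f_ n x @[n --> \oo] --> f x) ->
  \int[mu]_(x in D) (u x * f_ n x) @[n --> \oo] -->
  \int[mu]_(x in D) (u x * f x).
Proof.
move=> iu mf_ fC ff.
have fCl x : D x -> `|f x| <= C.
  move=> Dx; have /cvg_norm cf := ff _ Dx.
  apply: (ler_cvg_to cf (cvg_cst C)).
  by apply: nearW => n; exact: fC.
have mf : measurable_fun D f by exact: measurable_fun_cvg mf_ ff.
have mu_ : measurable_fun D u by apply/measurable_EFinP; exact: measurable_int iu.
have [|||||_ _ h] := @dominated_convergence _ _ _ mu _ mD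
   (fun n x => (u x * f_ n x)%:E) (fun x => (u x * f x)%:E)
   (fun x => (C * `|u x|)%:E).
- by move=> n; apply/measurable_EFinP; exact: measurable_funM.
- by apply/measurable_EFinP; exact: measurable_funM.
- apply: aeW => x Dx; apply: cvg_EFin; first exact: nearW.
  by apply: cvgM; [exact: cvg_cst|exact: ff].
- by apply: integrableZl_EFin; exact: integrable_norm.
- apply: aeW => x n Dx; rewrite /= lee_fin normrM mulrC ler_wpM2r ?fC//.
apply: fine_cvg; rewrite /Rintegral fineK//.
by apply: integrable_fin_num => //; exact: integrableM_bounded fCl.
Qed.

End BoundedMultipliers.

(** * Averages over the simple random walk *)

Section RandomWalk.
Context {R : realType}.
Implicit Types (a b : int -> R) (x j : int).

(** The mean of [a] at the position, after [N] steps, of the simple random walk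
    started at [x]; the recursion makes every estimate below an induction on [N],
    without binomial coefficients. *)
Fixpoint walk (N : nat) (a : int -> R) (x : int) : R :=
  if N is N'.+1 then (walk N' a (x + 1) + walk N' a (x - 1)) / 2 else a x.

Lemma walk_eigen N a (c : R) x : (forall j, a (j + 1) + a (j - 1) = 2 * c * a j) ->
  walk N a x = c ^+ N * a x.
Proof.
move=> ac; elim: N x => [|N IH] x /=; first by rewrite expr0 mul1r.
by rewrite !IH -mulrDr ac exprS; field.
Qed.

Lemma ler_norm_walk N a b x : (forall j, `|a j| <= b j) ->
  `|walk N a x| <= walk N b x.
Proof.
move=> ab; elim: N x => [|N IH] x //=.
rewrite normrM [`|2^-1|]ger0_norm ?invr_ge0// ler_wpM2r ?invr_ge0//.
by rewrite (le_trans (ler_normD _ _))// lerD.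
Qed.

(** [cos (j y)] is an eigenvector of the averaging operator; its eigenvalue
    [cos y] is the characteristic function of one step. *)
Lemma walk_cos N (y : R) : walk N (fun j => cos (j%:~R * y)) 0 = cos y ^+ N.
Proof.
rewrite (@walk_eigen _ _ (cos y)) ?mul0r ?cos0 ?mulr1// => j.
by rewrite !(intrD, intrN, mulr1z, mulrDl, mulNr, mul1r) cosD cosB; ring.
Qed.

Lemma expR_le_quad (y : R) : y <= 2^-1 -> expR y <= 1 + y + 2 * y ^+ 2.
Proof.
(* 1 - y <= exp (- y) inverts to exp y <= 1 / (1 - y), and
   (1 - y) (1 + y + 2 y^2) >= 1 as soon as y <= 1/2 *)
move=> y2; have y1 : 0 < 1 - y by lra.
have h : 1 - y <= expR (- y) by exact: expR_ge1Dx.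
have : expR y <= (1 - y)^-1.
  by rewrite -[expR y]invrK -expRN lef_pV2 ?posrE ?expR_gt0.
move/le_trans; apply; rewrite -[(1 - y)^-1]mul1r ler_pdivrMr//.
by have := sqr_ge0 y; nra.
Qed.

Lemma cosh_le (l : R) : `|l| <= 2^-1 ->
  (expR l + expR (- l)) / 2 <= expR (2 * l ^+ 2).
Proof.
rewrite ler_norml => /andP[l1 l2]; apply: le_trans (expR_ge1Dx _).
have := expR_le_quad l2; have := expR_le_quad (ltac:(lra) : - l <= 2^-1).
by rewrite sqrrN; lra.
Qed.

(** Chernoff bound: [|a|] is dominated by
    [M exp (- l J) (exp (l j) + exp (- l j))], an eigenvector of the averaging
    operator, and [l] is chosen to minimise [2 l ^ 2 N - l J]. *)
Lemma walk_tail N a (M J : R) : (0 < N)%N -> 0 <= J <= 2 * N%:R ->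
  (forall j, `|a j| <= M) -> (forall j, `|j%:~R| < J -> a j = 0) ->
  `|walk N a 0| <= 2 * M * expR (- (J ^+ 2 / (8 * N%:R))).
Proof.
move=> N0 /andP[J0 JN] aM a0; have NR : 0 < N%:R :> R by rewrite ltr0n.
have M0 : 0 <= M by exact: le_trans (aM 0).
pose l := J / (4 * N%:R).
have l0 : 0 <= l by rewrite divr_ge0// mulr_ge0.
have l2 : `|l| <= 2^-1.
  by rewrite ger0_norm// /l ler_pdivrMr ?mulr_gt0//; lra.
pose b (j : int) : R :=
  M * expR (- (l * J)) * (expR (l * j%:~R) + expR (- (l * j%:~R))).
have ab j : `|a j| <= b j.
  have [jJ|jJ] := ltP `|j%:~R| J.
    by rewrite a0// normr0 !mulr_ge0 ?addr_ge0 ?expR_ge0.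
  rewrite (le_trans (aM j))// /b -mulrA ler_peMr//.
  rewrite mulrDr -!expRD.
  have [j0|j0] := leP 0 (j%:~R : R).
    rewrite -[leLHS]addr0 lerD ?expR_ge0// -[leLHS]expR0 ler_expR.
    by rewrite ger0_norm// in jJ; have := ler_wpM2l l0 jJ; lra.
  rewrite -[leLHS]add0r lerD ?expR_ge0// -[leLHS]expR0 ler_expR.
  by rewrite ltr0_norm// in jJ; have := ler_wpM2l l0 jJ; lra.
rewrite (le_trans (ler_norm_walk _ _ ab))//.
rewrite (@walk_eigen _ _ ((expR l + expR (- l)) / 2)); last first.
  move=> j; rewrite /b !(intrD, intrN, mulr1z, mulrDr, mulrN, mulr1, opprD, opprK, expRD).
  by field.
rewrite /b mulr0 oppr0 expR0.
apply: (@le_trans _ _ (expR (2 * l ^+ 2) ^+ N * (M * expR (- (l * J)) * (1 + 1)))).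
  apply: ler_wpM2r; first by rewrite !mulr_ge0 ?expR_ge0.
  by rewrite lerXn2r ?nnegrE ?expR_ge0 ?divr_ge0 ?addr_ge0 ?expR_ge0 ?cosh_le.
have -> : - (J ^+ 2 / (8 * N%:R)) = N%:R * (2 * l ^+ 2) - l * J.
  by rewrite /l; field; rewrite gt_eqF.
rewrite expRD [expR (N%:R * _)]expRM_natl le_eqVlt; apply/orP; left.
by apply/eqP; ring.
Qed.

End RandomWalk.

Section WalkMoments.
Context d (T : measurableType d) (R : realType).
Context (mu : {measure set T -> \bar R}) (D : set T) (mD : measurable D).
Context (u : T -> R) (F : int -> T -> R).
Hypothesis iu : mu.-integrable D (EFin \o u).
Hypothesis mF : forall j, measurable_fun D (F j).
Hypothesis F1 : forall j x, D x -> `|F j x| <= 1.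

Lemma walk_Rintegral N j :
  mu.-integrable D (EFin \o (fun x => u x * walk N (F ^~ x) j)) /\
  \int[mu]_(x in D) (u x * walk N (F ^~ x) j) =
  walk N (fun k => \int[mu]_(x in D) (u x * F k x)) j.
Proof.
elim: N j => [|N IH] j /=.
  by split => //; exact: integrableM_bounded (F1 j).
have [i1 e1] := IH (j + 1); have [i2 e2] := IH (j - 1).
rewrite -e1 -e2 (mulrC _ 2^-1) -RintegralD// -RintegralZl//; last exact: integrableD_EFin.
have := integrableZl_EFin mD 2^-1 (integrableD_EFin mD i1 i2) => i3.
split.
  by apply: eq_integrable i3 => // x _ /=; congr EFin; lra.
by apply: eq_Rintegral => x _; lra.
Qed.

(** If the moments of [u] against the [F j] vanish for [|j| < J], only the walks
    ending at distance [J] or more contribute, hence the Gaussian tail. *)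
Lemma walk_moment_le N (J : R) : (0 < N)%N -> 0 <= J <= 2 * N%:R ->
  (forall j, `|j%:~R| < J -> \int[mu]_(x in D) (u x * F j x) = 0) ->
  `|\int[mu]_(x in D) (u x * walk N (F ^~ x) 0)| <=
  2 * (\int[mu]_(x in D) `|u x|) * expR (- (J ^+ 2 / (8 * N%:R))).
Proof.
move=> N0 JN uF; rewrite (walk_Rintegral N 0).2; apply: walk_tail => // j.
by rewrite -[leRHS]mul1r; exact: le_normr_RintegralM (F1 j).
Qed.

End WalkMoments.

(** * Two limits of real functions *)

Section RealLimits.
Context {R : realType}.
Implicit Types (c x v : R).

Lemma cvg_expR_mulN c : 0 < c -> expR (- (c * n.+1%:R)) @[n --> \oo] --> (0 : R).
Proof.
move=> c0; apply: (@squeeze_cvgr _ _ _ _ (fun=> 0) (fun n => c^-1 * harmonic n)).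
- apply: nearW => n; rewrite expR_ge0/= /harmonic/= expRN -invfM.
  rewrite lef_pV2 ?posrE ?expR_gt0 ?mulr_gt0//.
  by rewrite (le_trans _ (expR_ge1Dx _))// lerDr.
- exact: cvg_cst.
- rewrite -[X in _ --> X](mulr0 c^-1); apply: cvgM; first exact: cvg_cst.
  exact: cvg_harmonic.
Qed.

Lemma cvg_mul_sin c : n.+1%:R * sin (c / n.+1%:R) @[n --> \oo] --> c.
Proof.
have [->|c0] := eqVneq c 0.
  under eq_fun do rewrite mul0r sin0 mulr0.
  exact: cvg_cst.
have sin' : h^-1 *: (sin (h *: 1 + 0) - sin 0) @[h --> (0 : R)^'] --> (1 : R).
  have [dsin Dsin] := is_derive_sin (0 : R).
  by rewrite cos0 in Dsin; rewrite -[X in _ --> X]Dsin; apply: dsin.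
pose h n : R := c * harmonic n.
have hc n : h n = c / n.+1%:R by [].
have hN0 n : h n != 0 by rewrite hc mulf_neq0// invr_eq0 pnatr_eq0.
have h0 : h n @[n --> \oo] --> (0 : R)^'.
  have h0 : h n @[n --> \oo] --> (0 : R).
    by rewrite -(mulr0 c); apply: cvgM; [exact: cvg_cst|exact: cvg_harmonic].
  move=> A hA.
  have : \forall n \near \oo, h n != 0 -> A (h n) := h0 _ hA.
  by apply: (@filterS nat \oo) => n; apply; exact: hN0.
have := cvg_comp _ _ h0 sin'.
move=> /(cvgM (cvg_cst c)); rewrite mulr1; apply: cvg_trans; apply: near_eq_cvg.
apply: nearW => n /=; rewrite scaler1 addr0 sin0 subr0 hc.
rewrite /GRing.scale/=; field.
by rewrite nat1r pnatr_eq0.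
Qed.

Lemma ler_norm_subX (a b : R) N : `|a| <= 1 -> `|b| <= 1 ->
  `|a ^+ N - b ^+ N| <= N%:R * `|a - b|.
Proof.
move=> a1 b1; rewrite subrXX normrM mulrC ler_wpM2r//.
rewrite (le_trans (ler_norm_sum _ _ _))//.
rewrite (@le_trans _ _ (\sum_(i < N) 1))//; last by rewrite sumr_const card_ord.
by apply: ler_sum => i _; rewrite normrM !normrX mulr_ile1 ?exprn_ile1 ?exprn_ge0.
Qed.

(** The central limit theorem for the simple walk of length [n ^ 2] scaled by [n],
    on the side of characteristic functions.  As [cos (x / n) = 1 - v] with
    [n ^ 2 v] convergent, the error between [(1 - v) ^ (n ^ 2)] and
    [exp (- v n ^ 2)] is at most [2 (n v) ^ 2]. *)
Lemma cvg_cosX x :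
  cos (x / n.+1%:R) ^+ (n.+1 ^ 2) @[n --> \oo] --> expR (- (x ^+ 2 / 2)).
Proof.
pose s n : R := n.+1%:R * sin (x / 2 / n.+1%:R).
pose v n : R := 2 * (s n * harmonic n) ^+ 2.
have cosv n : cos (x / n.+1%:R) = 1 - v n.
  rewrite /v /s /harmonic/= mulrAC mulfV ?pnatr_eq0// mul1r.
  rewrite (_ : x / n.+1%:R = x / 2 / n.+1%:R + x / 2 / n.+1%:R); last first.
    by field; rewrite ?nat1r ?pnatr_eq0.
  by rewrite cosD -!expr2 sin2cos2; ring.
have v0 n : 0 <= v n by rewrite mulr_ge0 ?sqr_ge0.
have sx : s n @[n --> \oo] --> x / 2 by exact: cvg_mul_sin.
have s2 : 2 * s n ^+ 2 @[n --> \oo] --> x ^+ 2 / 2.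
  rewrite (_ : x ^+ 2 / 2 = 2 * (x / 2 * (x / 2))); last by field.
  by apply: cvgM; [exact: cvg_cst|exact: cvgM].
have e2 : expR (- (2 * s n ^+ 2)) @[n --> \oo] --> expR (- (x ^+ 2 / 2)).
  by apply: continuous_cvg; [exact: continuous_expR|exact: cvgN].
have d0 : (2 * s n ^+ 2) ^+ 2 * 2 * harmonic n ^+ 2 @[n --> \oo] --> (0 : R).
  rewrite (_ : 0 = (x ^+ 2 / 2) * (x ^+ 2 / 2) * 2 * (0 * 0)); last by rewrite mulr0 mulr0.
  apply: cvgM; first by apply: cvgM; [exact: cvgM|exact: cvg_cst].
  by apply: cvgM; exact: cvg_harmonic.
pose r n : R := cos (x / n.+1%:R) ^+ (n.+1 ^ 2) - expR (- (2 * s n ^+ 2)).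
have r0 : r n @[n --> \oo] --> (0 : R).
  apply: (@squeeze_cvgr _ _ _ _
    (fun n => - ((2 * s n ^+ 2) ^+ 2 * 2 * harmonic n ^+ 2))
    (fun n => (2 * s n ^+ 2) ^+ 2 * 2 * harmonic n ^+ 2)) => //; last first.
    by rewrite -oppr0; exact: cvgN.
  apply: nearW => n; rewrite -ler_norml /r.
  have -> : 2 * s n ^+ 2 = (n.+1 ^ 2)%:R * v n.
    by rewrite /v natrX /harmonic/=; field; rewrite ?nat1r ?pnatr_eq0.
  rewrite -mulrN expRM_natl.
  apply: (le_trans (ler_norm_subX _ _ _)); first exact: cos_max.
    by rewrite ger0_norm ?expR_ge0// expR_le1 oppr_le0.
  have dv : `|cos (x / n.+1%:R) - expR (- v n)| <= 2 * v n ^+ 2.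
    have := expR_le_quad (ltac:(have := v0 n; lra) : - v n <= 2^-1).
    have := expR_ge1Dx (- v n); rewrite cosv sqrrN ler_norml.
    by have := sqr_ge0 (v n); lra.
  rewrite (le_trans (ler_wpM2l _ dv))// le_eqVlt; apply/orP; left; apply/eqP.
  by rewrite natrX /harmonic/=; field; rewrite ?nat1r ?pnatr_eq0.
have -> : (fun n => cos (x / n.+1%:R) ^+ (n.+1 ^ 2)) =
    (fun n => r n + expR (- (2 * s n ^+ 2))).
  by apply/funext => n; rewrite /r subrK.
by rewrite -[X in _ --> X]add0r; exact: cvgD.
Qed.

End RealLimits.

(** * From a spectral gap to the Laplace transform near 0 *)

Section OneSidedTransforms.
Context {R : realType} (u : R -> R).
Notation mu := (@lebesgue_measure R).
Notation D := (`]0%R, +oo[%classic : set R).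
Hypothesis iu : mu.-integrable D (EFin \o u).

Section SpectralGap.
Context (delta : R) (delta_gt0 : 0 < delta).
Hypothesis ucos : forall w : R, `|w| < delta ->
  \int[mu]_(t in D) (u t * cos (w * t)) = 0.
Hypothesis usin : forall w : R, `|w| < delta ->
  \int[mu]_(t in D) (u t * sin (w * t)) = 0.

Lemma gap_cos_shift w a : `|w| < delta ->
  \int[mu]_(t in D) (u t * cos (w * t + a)) = 0.
Proof.
move=> wd.
have mt (f : R -> R) : measurable_fun setT f -> measurable_fun D (fun t => f (w * t)).
  by move=> mf; apply: measurableT_comp => //; exact: measurable_funM.
have i1 : mu.-integrable D (EFin \o (fun t => u t * cos (w * t))).
  apply: (@integrableM_bounded _ _ _ _ _ _ _ _ 1) => //.
    by apply: mt; exact: measurable_cos.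
  by move=> x _; exact: cos_max.
have i2 : mu.-integrable D (EFin \o (fun t => u t * sin (w * t))).
  apply: (@integrableM_bounded _ _ _ _ _ _ _ _ 1) => //.
    by apply: mt; exact: measurable_sin.
  by move=> x _; exact: sin_max.
transitivity (cos a * \int[mu]_(t in D) (u t * cos (w * t)) -
  sin a * \int[mu]_(t in D) (u t * sin (w * t))); last first.
  by rewrite ucos// usin// !mulr0 subr0.
rewrite -!RintegralZl// -RintegralB//; [|exact: integrableZl_EFin..].
by apply: eq_Rintegral => t _; rewrite cosD; ring.
Qed.

(** The cosines of [walk_moment_le] are taken at the frequencies [j / (k m)], so
    that the gap contains those with [|j| < delta k m]; the walk has length
    [m ^ 2], and the bound does not depend on [m]. *)
Lemma gap_gauss_le (k tau : R) : 0 < k ->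
  `|\int[mu]_(t in D) (u t * expR (- (((t + tau) / k) ^+ 2 / 2)))| <=
  2 * (\int[mu]_(t in D) `|u t|) * expR (- (delta ^+ 2 * k ^+ 2 / 8)).
Proof.
move=> k0.
pose f m t : R := cos ((t + tau) / k / m.+1%:R) ^+ (m.+1 ^ 2).
have mf m : measurable_fun D (f m).
  apply: measurable_funX; apply: measurableT_comp; first exact: measurable_cos.
  by do 2 (apply: measurable_funM => //); exact: measurable_funD.
have f1 m t : D t -> `|f m t| <= 1.
  by move=> _; rewrite normrX exprn_ile1 ?cos_max.
have fx t : D t -> f m t @[m --> \oo] --> expR (- (((t + tau) / k) ^+ 2 / 2)).
  by move=> _; exact: cvg_cosX.
have /cvg_norm h :=
  @cvg_RintegralM _ _ _ mu D (measurable_itv _) _ _ _ _ iu mf f1 fx.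
apply: (ler_cvg_to h (cvg_cst _)).
near=> m.
pose F (j : int) (t : R) := cos (j%:~R * ((t + tau) / k / m.+1%:R)).
have fF : \int[mu]_(t in D) (u t * f m t) =
    \int[mu]_(t in D) (u t * walk (m.+1 ^ 2) (F ^~ t) 0).
  by apply: eq_Rintegral => t _; rewrite walk_cos.
have m0 : 0 < m.+1%:R :> R by rewrite ltr0n.
pose J := delta * k * m.+1%:R.
rewrite fF.
have -> : delta ^+ 2 * k ^+ 2 / 8 = J ^+ 2 / (8 * (m.+1 ^ 2)%:R).
  by rewrite natrX /J; field; rewrite nat1r gt_eqF.
apply: walk_moment_le => //.
- move=> j; apply: measurableT_comp; first exact: measurable_cos.
  by do 3 (apply: measurable_funM => //); exact: measurable_funD.
- by move=> j t _; exact: cos_max.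
- have J0 : 0 <= J by rewrite /J !mulr_ge0 ?ltW.
  rewrite J0/= /J natrX expr2 mulrA ler_wpM2r ?(ltW m0)//.
  suff : delta * k <= m.+1%:R.
    by move/le_trans; apply; rewrite ler_peMl ?ler1n ?(ltW m0).
  near: m; exists (Num.trunc (delta * k)) => // m /= lem.
  by rewrite (le_trans (ltW (truncnS_gt _)))// ler_nat ltnS.
- move=> j jJ; rewrite /F.
  have jw : `|j%:~R / k / m.+1%:R| < delta.
    rewrite -mulrA -invfM normrM [`|_^-1|]gtr0_norm ?invr_gt0 ?mulr_gt0//.
    by rewrite ltr_pdivrMr ?mulr_gt0// mulrA.
  apply: etrans (gap_cos_shift (j%:~R * tau / k / m.+1%:R) jw).
  apply: eq_Rintegral => t _; congr (_ * cos _); field.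
  by rewrite nat1r !gt_eqF.
Unshelve. all: by end_near. Qed.

(** Completing the square turns [exp (- s t - t ^ 2 / 2 k ^ 2)] into a Gaussian
    centred at [- s k ^ 2] times [exp ((s k) ^ 2 / 2)]; since [s < delta / 2],
    the factor [exp (- (delta k) ^ 2 / 8)] due to the gap beats the latter. *)
Lemma gap_laplace0 s : 0 < s < delta / 2 ->
  \int[mu]_(t in D) (u t * expR (- (s * t))) = 0.
Proof.
move=> /andP[s0 sd].
pose g n t : R := expR (- (s * t) - (t / n.+1%:R) ^+ 2 / 2).
pose M := \int[mu]_(t in D) `|u t|.
have M0 : 0 <= M by apply: Rintegral_ge0.
have mg n : measurable_fun D (g n).
  apply: measurableT_comp => //; apply: measurable_funB.
    by apply: measurableT_comp => //; exact: measurable_funM.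
  by apply: measurable_funM => //; apply: measurable_funX; exact: measurable_funM.
have cvg_g : \int[mu]_(t in D) (u t * g n t) @[n --> \oo] -->
             \int[mu]_(t in D) (u t * expR (- (s * t))).
  apply: (@cvg_RintegralM _ _ _ _ _ _ _ _ _ 1) => //.
  - move=> n t; rewrite /= in_itv/= andbT => t0.
    rewrite ger0_norm ?expR_ge0// expR_le1 -opprD oppr_le0.
    by rewrite addr_ge0 ?mulr_ge0 ?sqr_ge0 ?ltW.
  - move=> t _; apply: continuous_cvg; first exact: continuous_expR.
    rewrite -[X in _ --> X]subr0; apply: cvgB; first exact: cvg_cst.
    rewrite -(mul0r 2^-1); apply: cvgM; last exact: cvg_cst.
    have h0 : t / n.+1%:R @[n --> \oo] --> (0 : R).
      by rewrite -(mulr0 t); apply: cvgM; [exact: cvg_cst|exact: cvg_harmonic].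
    by rewrite -(mulr0 0); exact: cvgM.
have c0 : 0 < delta ^+ 2 / 8 - s ^+ 2 / 2 by nra.
have cvg_g0 : \int[mu]_(t in D) (u t * g n t) @[n --> \oo] --> (0 : R).
  apply/norm_cvg0P.
  apply: (@squeeze_cvgr _ _ _ _ (fun=> 0)
    (fun n => 2 * M * expR (- ((delta ^+ 2 / 8 - s ^+ 2 / 2) * n.+1%:R)))).
  - apply: nearW => n; rewrite normr_ge0/=.
    have n0 : 0 < n.+1%:R :> R by rewrite ltr0n.
    have -> : \int[mu]_(t in D) (u t * g n t) = expR (s ^+ 2 * n.+1%:R ^+ 2 / 2) *
        \int[mu]_(t in D) (u t * expR (- (((t + s * n.+1%:R ^+ 2) / n.+1%:R) ^+ 2 / 2))).
      rewrite -RintegralZl//.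
        apply: eq_Rintegral => t _; rewrite mulrCA -expRD; congr (_ * expR _).
        by field; rewrite nat1r gt_eqF.
      apply: (@integrableM_bounded _ _ _ _ _ _ _ _ 1) => //.
        apply: measurableT_comp => //; apply: measurableT_comp => //.
        apply: measurable_funM => //; apply: measurable_funX.
        by apply: measurable_funM => //; exact: measurable_funD.
      move=> t _; rewrite ger0_norm ?expR_ge0// expR_le1 oppr_le0.
      by rewrite mulr_ge0 ?sqr_ge0.
    rewrite normrM ger0_norm ?expR_ge0//.
    rewrite (le_trans (ler_wpM2l (expR_ge0 _) (gap_gauss_le (s * n.+1%:R ^+ 2) n0)))//.
    rewrite mulrCA ler_wpM2l ?mulr_ge0// -expRD ler_expR.
    have : (delta ^+ 2 / 8 - s ^+ 2 / 2) * n.+1%:R <=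
           (delta ^+ 2 / 8 - s ^+ 2 / 2) * n.+1%:R ^+ 2.
      by rewrite ler_wpM2l ?(ltW c0)// expr2 ler_peMl ?ler1n// ltW.
    by lra.
  - exact: cvg_cst.
  - rewrite -(mulr0 (2 * M)); apply: cvgM; first exact: cvg_cst.
    exact: cvg_expR_mulN.
exact: (cvg_unique (@Rhausdorff R) cvg_g cvg_g0).
Qed.

End SpectralGap.

(** * Uniqueness for the Laplace transform known near 0 *)

Section Laplace.
Let M : R := \int[mu]_(t in D) `|u t|.

Let integrable_expM (f : R -> R) (s : R) : 0 <= s -> measurable_fun D f ->
  (forall t, D t -> `|f t| <= 1) ->
  mu.-integrable D (EFin \o (fun t => u t * (expR (- (s * t)) * f t))).
Proof.
move=> s0 mf f1; apply: (@integrableM_bounded _ _ _ _ _ _ _ _ 1) => //.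
  apply: measurable_funM => //; apply: measurableT_comp => //.
  by apply: measurableT_comp => //; exact: measurable_funM.
move=> t Dt; rewrite normrM mulr_ile1 ?f1//.
rewrite ger0_norm ?expR_ge0// expR_le1 oppr_le0 mulr_ge0//.
by move: Dt; rewrite /= in_itv/= andbT => /ltW.
Qed.

Let integrable_exp (s : R) : 0 <= s ->
  mu.-integrable D (EFin \o (fun t => u t * expR (- (s * t)))).
Proof.
move=> s0; have := @integrable_expM (fun=> 1) s s0.
move=> /(_ ltac:(exact: measurable_cst) ltac:(by move=> *; rewrite normr1)).
by apply: eq_integrable => // t _ /=; rewrite mulr1.
Qed.

(** The Chebyshev recurrence writes [cos (n phi)] as a polynomial of degree [n]
    in [cos phi = exp (- h t)].  The factor [exp (- k h t)] is carried along
    because each use of the recurrence multiplies by one more [cos phi];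
    measurability is part of the induction because [phi] is arbitrary. *)
Lemma laplace0_chebyshev (A h : R) (phi : R -> R) : 0 < h ->
  (forall t, D t -> cos (phi t) = expR (- (h * t))) ->
  (forall s : R, 0 <= s < A -> \int[mu]_(t in D) (u t * expR (- (s * t))) = 0) ->
  forall n, measurable_fun D (fun t => cos (n%:R * phi t)) /\
    forall k, (k + n)%:R * h < A ->
    \int[mu]_(t in D) (u t * (expR (- (k%:R * h * t)) * cos (n%:R * phi t))) = 0.
Proof.
move=> h0 cphi uA n.
pose P n := measurable_fun D (fun t => cos (n%:R * phi t)) /\
  forall k, (k + n)%:R * h < A ->
  \int[mu]_(t in D) (u t * (expR (- (k%:R * h * t)) * cos (n%:R * phi t))) = 0.
suff : P n /\ P n.+1 by case.
have mexp : measurable_fun D (fun t => expR (- (h * t))).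
  apply: measurableT_comp => //.
  by apply: measurableT_comp => //; exact: measurable_funM.
elim: n => [|n [[mn IHn] [mn1 IHn1]]].
  split; split.
  - by apply: (@eq_measurable_fun _ _ _ _ D (fun=> 1 : R)) => // t _; rewrite mulr0n mul0r cos0.
  - move=> k; rewrite addn0 => kA; rewrite -[RHS](uA (k%:R * h)).
      by apply: eq_Rintegral => t _; rewrite mulr0n mul0r cos0 mulr1.
    by rewrite kA mulr_ge0// ltW.
  - apply: eq_measurable_fun mexp => t; rewrite inE => Dt.
    by rewrite mulr1n mul1r cphi.
  - move=> k; rewrite addn1 => kA; rewrite -[RHS](uA (k.+1%:R * h)).
      apply: eq_Rintegral => t; rewrite inE => Dt; rewrite mulr1n mul1r cphi// -expRD.
      by congr (_ * expR _); rewrite -natr1; ring.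
    by rewrite kA mulr_ge0// ltW.
split; first by split.
have rec t : D t -> cos (n.+2%:R * phi t) =
    2 * (expR (- (h * t)) * cos (n.+1%:R * phi t)) - cos (n%:R * phi t).
  move=> Dt; rewrite -cphi//.
  rewrite (_ : n.+2%:R * phi t = n.+1%:R * phi t + phi t); last first.
    by rewrite -!natr1; ring.
  rewrite (_ : n%:R * phi t = n.+1%:R * phi t - phi t); last first.
    by rewrite -!natr1; ring.
  by rewrite cosD cosB; ring.
split.
  apply: (@eq_measurable_fun _ _ _ _ D (fun t =>
    2 * (expR (- (h * t)) * cos (n.+1%:R * phi t)) - cos (n%:R * phi t))).
    by move=> t; rewrite inE => /rec.
  apply: measurable_funB => //; apply: measurable_funM => //.
  exact: measurable_funM.
move=> k kA.
have kA1 : (k.+1 + n.+1)%:R * h < A by rewrite addSnnS.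
have kA0 : (k + n)%:R * h < A.
  by apply: le_lt_trans kA; rewrite ler_pM2r// ler_nat leq_add2l leqW.
transitivity (2 * \int[mu]_(t in D) (u t * (expR (- (k.+1%:R * h * t)) * cos (n.+1%:R * phi t)))
  - \int[mu]_(t in D) (u t * (expR (- (k%:R * h * t)) * cos (n%:R * phi t)))); last first.
  by rewrite IHn// IHn1// mulr0 subr0.
have ik (j l : nat) : measurable_fun D (fun t => cos (l%:R * phi t)) ->
    mu.-integrable D (EFin \o (fun t => u t * (expR (- (j%:R * h * t)) * cos (l%:R * phi t)))).
  by move=> ml; apply: integrable_expM => //; [rewrite mulr_ge0// ltW|move=> *; exact: cos_max].
rewrite -RintegralZl//; last exact: ik.
rewrite -RintegralB//; [|by apply: integrableZl_EFin => //; exact: ik|exact: ik].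
apply: eq_Rintegral => t; rewrite inE => Dt; rewrite rec//.
rewrite (_ : - (k.+1%:R * h * t) = - (k%:R * h * t) - h * t); last first.
  by rewrite -!natr1; ring.
by rewrite expRD; ring.
Qed.

(** With [exp (- h t) = cos phi] and [h = B / m], the function [exp (- B t)] is
    [cos phi ^ m], the average of the [cos (j phi)] over the walk of length [m];
    those of index below [A / h] have zero moment. *)
Lemma laplace0_extend (A : R) : 0 < A ->
  (forall s : R, 0 <= s < A -> \int[mu]_(t in D) (u t * expR (- (s * t))) = 0) ->
  forall B : R, 0 <= B -> \int[mu]_(t in D) (u t * expR (- (B * t))) = 0.
Proof.
move=> A0 uA B B0; have [BA|AB] := ltP B A; first by apply: uA; rewrite B0.
have {}B0 : 0 < B by exact: lt_le_trans AB.
pose c := A ^+ 2 / B ^+ 2 / 8.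
have c0 : 0 < c by rewrite !divr_gt0 ?exprn_gt0.
suff le_c n : `|\int[mu]_(t in D) (u t * expR (- (B * t)))| <=
    2 * M * expR (- (c * n.+1%:R)).
  apply/eqP; rewrite -normr_le0.
  have lim0 : 2 * M * expR (- (c * n.+1%:R)) @[n --> \oo] --> (0 : R).
    rewrite -(mulr0 (2 * M)); apply: cvgM; first exact: cvg_cst.
    exact: cvg_expR_mulN.
  by apply: (ler_cvg_to (cvg_cst _) lim0); exact: nearW.
have n0 : 0 < n.+1%:R :> R by rewrite ltr0n.
pose h := B / n.+1%:R; have h0 : 0 < h by rewrite divr_gt0.
pose phi t := acos (expR (- (h * t))).
have cphi t : D t -> cos (phi t) = expR (- (h * t)).
  rewrite /= in_itv/= andbT => t0; apply: acosK; rewrite in_itv/=.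
  rewrite (le_trans _ (expR_ge0 _)) ?lerN10//= expR_le1 oppr_le0.
  by rewrite mulr_ge0 ?ltW.
have cheb := laplace0_chebyshev h0 cphi uA.
pose F (j : int) (t : R) := cos (j%:~R * phi t).
have FE j t : F j t = cos (`|j|%N%:R * phi t).
  rewrite /F; case: j => k; first by rewrite -pmulrn.
  by rewrite NegzE mulrNz mulNr cosN abszN -pmulrn.
have -> : \int[mu]_(t in D) (u t * expR (- (B * t))) =
    \int[mu]_(t in D) (u t * walk n.+1 (F ^~ t) 0).
  apply: eq_Rintegral => t; rewrite inE => Dt; rewrite walk_cos cphi//.
  rewrite -expRM_natl; congr (_ * expR _); rewrite /h; field.
  by rewrite nat1r gt_eqF.
pose J := A / h.
have -> : c * n.+1%:R = J ^+ 2 / (8 * n.+1%:R).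
  by rewrite /c /J /h; field; rewrite nat1r !gt_eqF.
apply: walk_moment_le => //.
- by move=> j; apply: eq_measurable_fun (cheb `|j|%N).1 => t _; rewrite FE.
- by move=> j t _; exact: cos_max.
- have J0 : 0 <= J by rewrite divr_ge0 ?ltW.
  rewrite J0/= /J ler_pdivrMr// (_ : 2 * n.+1%:R * h = 2 * B); first lra.
  by rewrite /h; field; rewrite nat1r gt_eqF.
- move=> j jJ; have jA : (0 + `|j|)%N%:R * h < A.
    by rewrite add0n natr_absz -ltr_pdivlMr// intr_norm.
  apply: etrans ((cheb `|j|%N).2 0 jA).
  by apply: eq_Rintegral => t _; rewrite !mul0r oppr0 expR0 mul1r FE.
Qed.

Lemma expR_series_le (y z : R) K : `|y| <= z ->
  `|series (exp_coeff y) K| <= expR z.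
Proof.
move=> yz; have z0 : 0 <= z by exact: le_trans yz.
apply: (@le_trans _ _ (series (exp_coeff z) K)).
  rewrite /series/= (le_trans (ler_norm_sum _ _ _))//; apply: ler_sum => i _.
  rewrite /exp_coeff/= normrM normfV normrX [`|i`!%:R|]ger0_norm//.
  by rewrite ler_wpM2r ?invr_ge0// lerXn2r ?nnegrE.
rewrite /expR; apply: nondecreasing_cvgn_le; last exact: is_cvg_series_exp_coeff.
by apply/nondecreasing_seqP => k; rewrite seriesSr lerDl exp_coeff_ge0.
Qed.

Hypothesis laplace0 : forall B : R, 0 <= B ->
  \int[mu]_(t in D) (u t * expR (- (B * t))) = 0.

(** The exponential series in [- a exp (- b t)] is a series in the
    [exp (- K b t)], with partial sums bounded by [exp a] on the half line. *)
Lemma laplace0_expexp (a b : R) : 0 <= a -> 0 <= b ->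
  \int[mu]_(t in D) (u t * expR (- (a * expR (- (b * t))))) = 0.
Proof.
move=> a0 b0.
pose y t := - (a * expR (- (b * t))).
have my : measurable_fun D y.
  apply: measurableT_comp => //; apply: measurable_funM => //.
  apply: measurableT_comp => //.
  by apply: measurableT_comp => //; exact: measurable_funM.
have ya t : D t -> `|y t| <= a.
  rewrite /= in_itv/= andbT => t0; rewrite /y normrN normrM !ger0_norm ?expR_ge0//.
  by rewrite ler_piMr// expR_le1 oppr_le0 mulr_ge0// ltW.
have mE k : measurable_fun D (fun t => exp_coeff (y t) k).
  by rewrite /exp_coeff/=; apply: measurable_funM => //; exact: measurable_funX.
have E1 k t : D t -> `|exp_coeff (y t) k| <= a ^+ k / k`!%:R.
  move=> Dt; rewrite /exp_coeff/= normrM normfV normrX [`|k`!%:R|]ger0_norm//.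
  by rewrite ler_wpM2r ?invr_ge0// lerXn2r ?nnegrE ?ya.
pose f K t := series (exp_coeff (y t)) K.
have f0 K : measurable_fun D (f K) /\ \int[mu]_(t in D) (u t * f K t) = 0.
  elim: K => [|K [mf IH]].
    rewrite /f /series; split.
      by apply: (@eq_measurable_fun _ _ _ _ D (fun=> 0 : R)) => // t _; rewrite /= big_geq.
    by under eq_Rintegral do rewrite /= big_geq// mulr0; rewrite Rintegral_cst// mul0r.
  have fS t : f K.+1 t = f K t + exp_coeff (y t) K by rewrite /f seriesSr.
  split.
    apply: (@eq_measurable_fun _ _ _ _ D (fun t => f K t + exp_coeff (y t) K)).
      by move=> t _; rewrite fS.
    exact: measurable_funD.
  under eq_Rintegral do rewrite fS mulrDr.
  rewrite RintegralD// ?IH ?add0r.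
  - transitivity ((- a) ^+ K / K`!%:R * \int[mu]_(t in D) (u t * expR (- (K%:R * b * t)))).
      rewrite -RintegralZl//.
        apply: eq_Rintegral => t _; rewrite /exp_coeff/= /y -mulNr exprMn -expRM_natl.
        by rewrite (_ : K%:R * - (b * t) = - (K%:R * b * t)); ring.
      by apply: integrable_exp; rewrite mulr_ge0.
    by rewrite laplace0 ?mulr0// mulr_ge0.
  - apply: (@integrableM_bounded _ _ _ _ _ _ _ _ (expR a)) => // t Dt.
    exact/expR_series_le/ya.
  - exact: (@integrableM_bounded _ _ _ _ _ _ _ _ _ iu (mE K) (E1 K)).
have fC K t : D t -> `|f K t| <= expR a by move=> Dt; exact/expR_series_le/ya.
have fy t : D t -> f K t @[K --> \oo] --> expR (y t).
  by move=> _; exact: is_cvg_series_exp_coeff.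
have := @cvg_RintegralM _ _ _ mu D (measurable_itv _) _ _ _ _ iu (fun K => (f0 K).1) fC fy.
under eq_fun do rewrite (f0 _).2.
by move/(cvg_unique (@Rhausdorff R) (cvg_cst 0)).
Qed.

(** [exp (- n exp (n (c - t)))] converges to the indicator of [c < t]; the outer
    factor [n] makes this true at [t = c] as well. *)
Lemma laplace0_tail (c : R) : \int[mu]_(t in D) (u t * (c < t)%R%:R) = 0.
Proof.
pose a n : R := n.+1%:R * expR (n.+1%:R * c).
pose g n t : R := expR (- (a n * expR (- (n.+1%:R * t)))).
have a0 n : 0 <= a n by rewrite mulr_ge0 ?expR_ge0.
have mg n : measurable_fun D (g n).
  apply: measurableT_comp => //; apply: measurableT_comp => //.
  apply: measurable_funM => //; apply: measurableT_comp => //.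
  by apply: measurableT_comp => //; exact: measurable_funM.
have g1 n t : D t -> `|g n t| <= 1.
  move=> _; rewrite ger0_norm ?expR_ge0// expR_le1 oppr_le0.
  by rewrite mulr_ge0 ?expR_ge0.
have gE n t : g n t = expR (- (n.+1%:R * expR (n.+1%:R * (c - t)))).
  by rewrite /g /a -mulrA -expRD mulrBr.
have gc t : D t -> g n t @[n --> \oo] --> ((c < t)%R%:R : R).
  move=> _; under eq_fun do rewrite gE; have [ct|tc] := ltP c t.
    rewrite /= mulr1n -[X in nbhs X]expR0; apply: continuous_cvg; first exact: continuous_expR.
    rewrite -oppr0; apply: cvgN.
    (* n exp (- n d) -> 0 because exp (n d) >= (n d) ^ 2 / 2 *)
    apply: (@squeeze_cvgr _ _ _ _ (fun=> 0) (fun n => 2 / (t - c) ^+ 2 * harmonic n)).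
    - apply: nearW => n; rewrite mulr_ge0 ?expR_ge0//= -opprB mulrN expRN.
      have n0 : 0 < n.+1%:R :> R by rewrite ltr0n.
      have d0 : 0 < n.+1%:R * (t - c) by rewrite mulr_gt0 ?subr_gt0.
      have := expR_ge1Dxn 1 (ltW d0).
      rewrite ler_pdivrMr ?expR_gt0// /harmonic/=.
      set e := expR _ => le_e.
      rewrite -(@ler_pM2l _ ((t - c) ^+ 2 / 2 * n.+1%:R)); last first.
        by rewrite !mulr_gt0 ?exprn_gt0 ?subr_gt0.
      rewrite [leRHS](_ : _ = e); last by field; rewrite nat1r subr_eq0 !gt_eqF.
      apply: le_trans le_e; rewrite -[leLHS]add0r lerD// exprMn.
      by rewrite (_ : 2`!%:R = 2) //; lra.
    - exact: cvg_cst.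
    - rewrite -(mulr0 (2 / (t - c) ^+ 2)); apply: cvgM; first exact: cvg_cst.
      exact: cvg_harmonic.
  apply: (@squeeze_cvgr _ _ _ _ (fun=> 0) (fun n => expR (- (1 * n.+1%:R)))).
  - apply: nearW => n; rewrite expR_ge0/= ler_expR lerN2 mul1r ler_peMr//.
    by rewrite -[leLHS]expR0 ler_expR mulr_ge0// subr_ge0.
  - exact: cvg_cst.
  - exact: cvg_expR_mulN.
have := @cvg_RintegralM _ _ _ mu D (measurable_itv _) _ _ _ _ iu mg g1 gc.
under eq_fun do rewrite laplace0_expexp//.
by move/(cvg_unique (@Rhausdorff R) (cvg_cst 0)).
Qed.

(** All the integrals of [u] over [(0, x]] vanish: differentiate in [x]. *)
Lemma laplace0_ae0 : {ae mu, forall t, D t -> u t = 0}.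
Proof.
have iv : mu.-integrable setT (EFin \o (u \_ D)).
  rewrite -restrict_EFin; apply: (integrable_mkcond _ _).1 => //.
have iy y : mu.-integrable `]-oo, y] (EFin \o (u \_ D)).
  exact: integrableS iv.
have lv : locally_integrable [set: R] (u \_ D).
  by apply: open_integrable_locally => //; exact: openT.
have F0 x : \int[mu]_(t in `]-oo, x]) (u \_ D) t = 0.
  rewrite -Rintegral_mkcondr Rintegral_mkcondl.
  transitivity (\int[mu]_(t in D) (u t * expR (- (0 * t))) -
      \int[mu]_(t in D) (u t * (x < t)%R%:R)).
    have u0 : mu.-integrable D (EFin \o (fun t => u t * expR (- (0 * t)))).
      exact: integrable_exp.
    rewrite -RintegralB//; last first.
      apply: (@integrableM_bounded _ _ _ _ _ _ _ _ 1) => //.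
        apply: measurableT_comp => //; apply: measurable_fun_ltr => //.
      by move=> t _; case: ltP => _; rewrite ?normr1 ?normr0.
    apply: eq_Rintegral => t _; rewrite patchE mem_setE in_itv/= mul0r oppr0 expR0 mulr1.
    by case: ltP => _; rewrite ?mulr1 ?mulr0 ?subrr ?subr0.
  by rewrite laplace0// laplace0_tail subrr.
have := FTC1Ny iy lv.
apply: filterS; first exact: (ae_filter_ringOfSetsType mu).
move=> x [_].
rewrite (_ : (fun x => _) = cst 0); last by apply/funext => y; rewrite F0.
by rewrite derive1_cst patchE => + Dx; rewrite mem_set.
Qed.

End Laplace.

Theorem gap_ae0 (delta : R) : 0 < delta ->
  (forall w : R, `|w| < delta -> \int[mu]_(t in D) (u t * cos (w * t)) = 0) ->
  (forall w : R, `|w| < delta -> \int[mu]_(t in D) (u t * sin (w * t)) = 0) ->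
  {ae mu, forall t, D t -> u t = 0}.
Proof.
move=> d0 uc us; apply: laplace0_ae0.
apply: (@laplace0_extend (delta / 2)); first by rewrite divr_gt0.
move=> s /andP[]; rewrite le_eqVlt => /predU1P[<- _|s0 sd].
  rewrite -[RHS](uc 0) ?normr0//.
  by apply: eq_Rintegral => t _; rewrite !mul0r oppr0 expR0 cos0.
by apply: (gap_laplace0 d0 uc us); rewrite s0.
Qed.

End OneSidedTransforms.

(** * Integration by parts for primitives of integrable functions *)

Section ProductIntegrability.
Context d1 d2 (T1 : measurableType d1) (T2 : measurableType d2) (R : realType).
Context (m1 : {sigma_finite_measure set T1 -> \bar R}).
Context (m2 : {sigma_finite_measure set T2 -> \bar R}).

Lemma integrable_prodM (a : T1 -> R) (b : T2 -> R) (c : T1 * T2 -> R) :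
  m1.-integrable setT (EFin \o a) -> m2.-integrable setT (EFin \o b) ->
  measurable_fun setT c -> (forall z, `|c z| <= 1) ->
  (m1 \x m2)%E.-integrable setT (EFin \o (fun z => a z.1 * b z.2 * c z)).
Proof.
move=> ia ib mc c1.
have ma : measurable_fun setT a by apply/measurable_EFinP; exact: measurable_int ia.
have mb : measurable_fun setT b by apply/measurable_EFinP; exact: measurable_int ib.
have mf : measurable_fun setT (fun z : T1 * T2 => a z.1 * b z.2 * c z).
  apply: measurable_funM => //; apply: measurable_funM.
    exact: measurableT_comp measurable_fst.
  exact: measurableT_comp measurable_snd.
have mfE : measurable_fun setT (EFin \o (fun z : T1 * T2 => a z.1 * b z.2 * c z)).
  exact/measurable_EFinP.
apply/integrable12ltyP; first exact: mfE.
pose K := \int[m2]_y `|b y|.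
apply: (@le_lt_trans _ _ (\int[m1]_x (K * `|a x|)%:E)%E); last first.
  by apply: integrable_lty => //; apply: integrableZl_EFin => //; exact: integrable_norm.
have mK : measurable_fun setT (EFin \o (fun x => K * `|a x|)).
  by apply/measurable_EFinP; apply: measurable_funM => //; exact: measurableT_comp.
have mnb : measurable_fun setT (EFin \o (fun y => `|b y|)).
  by apply/measurable_EFinP; exact: measurableT_comp.
apply: ge0_le_integral => //.
- by move=> x _; apply: integral_ge0.
- apply: (measurable_fun_fubini_tonelli_F
    (abse \o (EFin \o (fun z : T1 * T2 => a z.1 * b z.2 * c z)))) => //.
    by apply: measurableT_comp => //; exact: mfE.
  by move=> z; exact: abse_ge0.
move=> x _; rewrite /K /Rintegral EFinM fineK; last first.
  by apply: integrable_fin_num => //; exact: integrable_norm.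
rewrite muleC -ge0_integralZl//.
apply: ge0_le_integral => //.
- apply: measurableT_comp => //.
  exact: (measurableT_comp mfE (measurable_pair1 x)).
- by apply: emeasurable_funM => //; apply/measurable_EFinP; exact: measurableT_comp.
move=> y _; rewrite /= lee_fin !normrM ler_piMr ?c1// mulr_ge0//.
Qed.

End ProductIntegrability.

Section IntegrationByParts.
Context {R : realType}.
Notation mu := (@lebesgue_measure R).

Section ContinuouslyDifferentiable.
Context (phi dphi : R -> R).
Hypothesis Dphi : forall x : R, is_derive x 1 phi (dphi x).
Hypothesis cdphi : continuous dphi.

Lemma continuous_integrable_itv (x y : R) (b0 b1 : bool) :
  mu.-integrable [set` Interval (BSide b0 x) (BSide b1 y)] (EFin \o dphi).
Proof.
have icc : mu.-integrable `[x, y] (EFin \o dphi).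
  apply: continuous_compact_integrable; first exact: segment_compact.
  exact: continuous_subspaceT.
apply: integrableS icc; [exact: measurable_itv|exact: measurable_itv|].
by apply: subset_itv; rewrite bnd_simp; case: b0 b1 => [] [].
Qed.

Lemma Rintegral_derive_oo (x y : R) : x <= y ->
  \int[mu]_(s in `]x, y[) dphi s = phi y - phi x.
Proof.
rewrite le_eqVlt => /predU1P[->|xy].
  by rewrite subrr set_itv_ge ?Rintegral_set0 ?bnd_simp ?ltxx.
rewrite Rintegral_itv_bndo_bndc; last exact: continuous_integrable_itv.
rewrite Rintegral_itv_obnd_cbnd; last exact: continuous_integrable_itv.
rewrite /Rintegral (@continuous_FTC2 _ dphi phi)//.
- exact: continuous_subspaceT.
- have cphi z : {for z, continuous phi}.
    by apply/differentiable_continuous/derivable1_diffP; case: (Dphi z).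
  split; first by move=> z _; case: (Dphi z).
    by apply: cvg_at_right_filter; exact: cphi.
  by apply: cvg_at_left_filter; exact: cphi.
- by move=> z _; rewrite derive1E; case: (Dphi z).
Qed.

(** Fubini for [dphi s * g x] on the triangle [x < s]. *)
Lemma by_parts_primitive0 (g : R -> R) (t : R) :
  mu.-integrable `]0, t[ (EFin \o g) ->
  let G s := \int[mu]_(x in `]0, s[) g x in
  mu.-integrable `]0, t[ (EFin \o (fun s => dphi s * G s)) /\
  \int[mu]_(s in `]0, t[) (dphi s * G s) =
  \int[mu]_(s in `]0, t[) ((phi t - phi s) * g s).
Proof.
move=> ig G; pose I := (`]0, t[%classic : set R).
pose a := dphi \_ I; pose b := g \_ I.
have ia : mu.-integrable setT (EFin \o a).
  rewrite -restrict_EFin; apply: (integrable_mkcond _ _).1; first exact: measurable_itv.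
  exact: continuous_integrable_itv.
have ib : mu.-integrable setT (EFin \o b).
  rewrite -restrict_EFin; apply: (integrable_mkcond _ _).1; last exact: ig.
  exact: measurable_itv.
pose c (z : R * R) : R := (z.2 < z.1)%R%:R.
have mc : measurable_fun setT c.
  apply: measurableT_comp => //.
  exact: measurable_fun_ltr measurable_snd measurable_fst.
have c1 z : `|c z| <= 1 by rewrite /c; case: ltP; rewrite ?normr1 ?normr0.
have iabc := integrable_prodM ia ib mc c1.
have inner1 s : (\int[mu]_x (a s * b x * c (s, x))%:E)%E =
    ((fun s => dphi s * G s) \_ I s)%:E.
  have mcs : measurable_fun setT (fun x => c (s, x)).
    exact: measurableT_comp (measurable_pair1 s).
  have ibc := integrableM_bounded measurableT ib mcs (fun x _ => c1 (s, x)).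
  under eq_integral do rewrite -mulrA EFinM.
  rewrite integralZl// -[X in (_ * X)%E]fineK ?integrable_fin_num// -EFinM; congr EFin.
  rewrite -/(Rintegral _ _ _) /a !patchE; case: ifPn => [|_]; last by rewrite mul0r.
  rewrite inE /I/= in_itv/= => /andP[s0 st]; congr (_ * _).
  rewrite /G [RHS]Rintegral_mkcond; apply: eq_Rintegral => x _.
  rewrite /b /c /I !patchE !mem_setE !in_itv/=.
  have [xs|sx] := ltP x s; last by rewrite andbF mulr0.
  by rewrite (lt_trans xs st) !andbT mulr1.
have inner2 x : (\int[mu]_s (a s * b x * c (s, x))%:E)%E =
    ((fun s => (phi t - phi s) * g s) \_ I x)%:E.
  have mcx : measurable_fun setT (fun s => c (s, x)).
    exact: measurableT_comp (measurable_pair2 x).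
  have iac := integrableM_bounded measurableT ia mcx (fun s _ => c1 (s, x)).
  under eq_integral do rewrite mulrAC EFinM.
  rewrite integralZr// -[X in (X * _)%E]fineK ?integrable_fin_num// -EFinM; congr EFin.
  rewrite -/(Rintegral _ _ _) /b !patchE; case: ifPn => [|_]; last by rewrite mulr0.
  rewrite inE /I/= in_itv/= => /andP[x0 xt]; congr (_ * _).
  rewrite -(Rintegral_derive_oo (ltW xt)) [RHS]Rintegral_mkcond.
  apply: eq_Rintegral => s _; rewrite /a /c /I !patchE !mem_setE !in_itv/=.
  have [xs|sx] := ltP x s; last by rewrite mulr0.
  by rewrite (lt_trans x0 xs) mulr1.
have FE : fubini_F mu (EFin \o (fun z => a z.1 * b z.2 * c z)) =
    EFin \o ((fun s => dphi s * G s) \_ I).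
  by apply/funext => s; exact: inner1.
split.
  apply: (integrable_mkcond _ _).2; first exact: measurable_itv.
  by rewrite restrict_EFin -FE; exact: integrable_fubini_F.
rewrite Rintegral_mkcond [RHS]Rintegral_mkcond /Rintegral; congr fine.
transitivity (\int[mu]_x \int[mu]_y (a x * b y * c (x, y))%:E)%E.
  by apply: eq_integral => s _; rewrite inner1.
rewrite (Fubini iabc); apply: eq_integral => x _; exact: inner2.
Qed.

(** Integration by parts against an absolutely continuous function: [G] is a
    primitive of a merely integrable [g]. *)
Lemma by_parts_primitive (g : R -> R) (g0 t : R) : (forall x, `|phi x| <= 1) ->
  0 <= t -> mu.-integrable `]0, t[ (EFin \o g) ->
  let G s := g0 + \int[mu]_(x in `]0, s[) g x in
  mu.-integrable `]0, t[ (EFin \o (fun s => phi s * g s + dphi s * G s)) /\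
  phi t * G t = phi 0 * g0 + \int[mu]_(s in `]0, t[) (phi s * g s + dphi s * G s).
Proof.
move=> phi1 t0 ig G; have [iG eG] := by_parts_primitive0 ig.
have mphi : measurable_fun (`]0, t[%classic : set R) phi.
  apply: measurable_funTS; apply: continuous_measurable_fun => z.
  by apply/differentiable_continuous/derivable1_diffP; case: (Dphi z).
have mD : measurable (`]0, t[%classic : set R) by exact: measurable_itv.
have ipg : mu.-integrable `]0, t[ (EFin \o (fun s => phi s * g s)).
  have := @integrableM_bounded _ _ _ mu _ mD _ _ 1 ig mphi (fun x _ => phi1 x).
  by apply: eq_integrable => // x _ /=; rewrite mulrC.
have id : mu.-integrable `]0, t[ (EFin \o (fun s => g0 * dphi s)).
  by apply: integrableZl_EFin => //; exact: continuous_integrable_itv.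
have idG : mu.-integrable `]0, t[ (EFin \o (fun s => dphi s * G s)).
  have := @integrableD_EFin _ _ _ mu _ mD _ _ id iG.
  by apply: eq_integrable => // x _ /=; rewrite /G mulrDr (mulrC g0).
split; first exact: integrableD_EFin.
rewrite RintegralD//.
have -> : \int[mu]_(s in `]0, t[) (dphi s * G s) = g0 * (phi t - phi 0) +
    (phi t * \int[mu]_(s in `]0, t[) g s - \int[mu]_(s in `]0, t[) (phi s * g s)).
  rewrite -(Rintegral_derive_oo t0) -!RintegralZl//; last exact: continuous_integrable_itv.
  rewrite -RintegralB//; last exact: integrableZl_EFin.
  have -> : \int[mu]_(s in `]0, t[) (phi t * g s - phi s * g s) =
      \int[mu]_(s in `]0, t[) ((phi t - phi s) * g s).
    by apply: eq_Rintegral => s _; rewrite mulrBl.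
  rewrite -eG -RintegralD//; apply: eq_Rintegral => s _.
  by rewrite /G mulrDr (mulrC g0).
by rewrite /G; ring.
Qed.

End ContinuouslyDifferentiable.

End IntegrationByParts.

(** * Integrals of complex functions *)

Local Open Scope complex_scope.

Section ComplexIntegral.
Context {R : realType}.
Notation mu := (@lebesgue_measure R).
Implicit Types (w g : R -> R[i]) (z c : R[i]) (x y : R).

Lemma Re_addc z c : complex.Re (z + c) = complex.Re z + complex.Re c.
Proof. by case: z; case: c. Qed.
Lemma Im_addc z c : complex.Im (z + c) = complex.Im z + complex.Im c.
Proof. by case: z; case: c. Qed.
Lemma Re_mulc z c : complex.Re (z * c) =
  complex.Re z * complex.Re c - complex.Im z * complex.Im c.
Proof. by case: z; case: c. Qed.
Lemma Im_mulc z c : complex.Im (z * c) =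
  complex.Re z * complex.Im c + complex.Im z * complex.Re c.
Proof. by case: z; case: c. Qed.
Lemma complex_eq z c :
  complex.Re z = complex.Re c -> complex.Im z = complex.Im c -> z = c.
Proof. by case: z; case: c => /= *; congr (_ +i* _). Qed.

Lemma Re_cintegral (D : set R) w :
  complex.Re (cintegral D w) = \int[mu]_(t in D) complex.Re (w t).
Proof. by []. Qed.
Lemma Im_cintegral (D : set R) w :
  complex.Im (cintegral D w) = \int[mu]_(t in D) complex.Im (w t).
Proof. by []. Qed.
Lemma Re_expi x : complex.Re (expi x) = cos x. Proof. by []. Qed.
Lemma Im_expi x : complex.Im (expi x) = sin x. Proof. by []. Qed.

Lemma expiD x y : expi (x + y) = expi x * expi y.
Proof.
by apply: complex_eq; rewrite ?Re_mulc ?Im_mulc /expi/= ?cosD ?sinD// addrC.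
Qed.

Lemma expi0 : expi 0 = 1 :> R[i].
Proof. by rewrite /expi cos0 sin0. Qed.

Lemma expiK x z : expi x * (expi (- x) * z) = z.
Proof. by rewrite mulrA -expiD subrr expi0 mul1r. Qed.

Section OnSet.
Context (D : set R) (mD : measurable D).

Lemma eq_cintegrable w g : {in D, w =1 g} -> cintegrable D w -> cintegrable D g.
Proof.
by move=> wg [iR iI]; split; [apply: eq_integrable iR|apply: eq_integrable iI];
  rewrite // => t Dt /=; rewrite wg.
Qed.

Lemma eq_cintegral w g : {in D, w =1 g} -> cintegral D w = cintegral D g.
Proof.
by move=> wg; congr (_ +i* _); apply: eq_Rintegral => t Dt; rewrite wg.
Qed.

Lemma cintegrableD w g : cintegrable D w -> cintegrable D g ->
  cintegrable D (fun t => w t + g t).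
Proof.
move=> [wR wI] [gR gI]; split.
  by under eq_fun do rewrite Re_addc; exact: integrableD_EFin.
by under eq_fun do rewrite Im_addc; exact: integrableD_EFin.
Qed.

Lemma cintegralD w g : cintegrable D w -> cintegrable D g ->
  cintegral D (fun t => w t + g t) = cintegral D w + cintegral D g.
Proof.
move=> [wR wI] [gR gI]; apply: complex_eq; rewrite ?Re_addc ?Im_addc /= -RintegralD//.
  by apply: eq_Rintegral => t _; rewrite Re_addc.
by apply: eq_Rintegral => t _; rewrite Im_addc.
Qed.

Lemma cintegrableZ c w : cintegrable D w -> cintegrable D (fun t => c * w t).
Proof.
move=> [wR wI]; split.
  under eq_fun do rewrite Re_mulc.
  by apply: integrableB_EFin => //; exact: integrableZl_EFin.
under eq_fun do rewrite Im_mulc.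
by apply: integrableD_EFin => //; exact: integrableZl_EFin.
Qed.

Lemma cintegralZ c w : cintegrable D w ->
  cintegral D (fun t => c * w t) = c * cintegral D w.
Proof.
move=> [wR wI]; apply: complex_eq; rewrite ?Re_mulc ?Im_mulc /= -!RintegralZl//.
  rewrite -RintegralB//; [|exact: integrableZl_EFin..].
  by apply: eq_Rintegral => t _; rewrite Re_mulc.
rewrite -RintegralD//; [|exact: integrableZl_EFin..].
by apply: eq_Rintegral => t _; rewrite Im_mulc.
Qed.

Lemma cintegrableN w : cintegrable D w -> cintegrable D (fun t => - w t).
Proof.
by move/(cintegrableZ (-1)); apply: eq_cintegrable => t _; rewrite mulN1r.
Qed.

Lemma cintegralN w : cintegrable D w ->
  cintegral D (fun t => - w t) = - cintegral D w.
Proof.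
move=> iw; rewrite -mulN1r -cintegralZ//.
by apply: eq_cintegral => t _; rewrite mulN1r.
Qed.

Lemma cintegrable_expi w (f : R -> R) : measurable_fun D f -> cintegrable D w ->
  cintegrable D (fun t => w t * expi (f t)).
Proof.
move=> mf [wR wI].
have mc : measurable_fun D (fun t => cos (f t)).
  by apply: measurableT_comp => //; exact: measurable_cos.
have ms : measurable_fun D (fun t => sin (f t)).
  by apply: measurableT_comp => //; exact: measurable_sin.
have iM (u g : R -> R) : mu.-integrable D (EFin \o u) -> measurable_fun D g ->
    (forall x, `|g x| <= 1) -> mu.-integrable D (EFin \o (fun t => u t * g t)).
  by move=> iu mg g1; exact: (@integrableM_bounded _ _ _ _ _ _ _ _ 1).
split.
  under eq_fun do rewrite Re_mulc.
  by apply: integrableB_EFin => //; apply: iM => // x; [exact: cos_max|exact: sin_max].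
under eq_fun do rewrite Im_mulc.
by apply: integrableD_EFin => //; apply: iM => // x; [exact: sin_max|exact: cos_max].
Qed.

End OnSet.

Lemma measurable_mull (D : set R) (a : R) : measurable_fun D (fun t => a * t).
Proof. by apply: measurable_funTS; exact: measurable_funM. Qed.

Lemma is_derive_cosM (a x : R) :
  is_derive x 1 (fun s => cos (a * s)) (- a * sin (a * x)).
Proof.
have h : is_derive x 1 (fun s : R => a * s) a.
  by apply: is_derive_eq; rewrite /GRing.scale/= mulr1.
have := @is_derive1_comp _ cos (fun s => a * s) x _ _ (is_derive_cos _) h.
move=> d; apply: (@is_derive_eq _ _ _ _ _ _ _ _ d).
by rewrite mulrC mulrN mulNr.
Qed.

Lemma is_derive_sinM (a x : R) :
  is_derive x 1 (fun s => sin (a * s)) (a * cos (a * x)).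
Proof.
have h : is_derive x 1 (fun s : R => a * s) a.
  by apply: is_derive_eq; rewrite /GRing.scale/= mulr1.
have := @is_derive1_comp _ sin (fun s => a * s) x _ _ (is_derive_sin _) h.
move=> d; apply: (@is_derive_eq _ _ _ _ _ _ _ _ d).
by rewrite mulrC.
Qed.

(** The product rule [(exp (i a s) G s)' = exp (i a s) (g s + i a G s)] in
    integrated form, [G] being a primitive of [g].  With frequency [a] it shows that
    the variation-of-constants formula is a solution, with [- a] that it is the
    only one. *)
Lemma expi_primitive (a t : R) (g : R -> R[i]) z : 0 <= t ->
  cintegrable `]0, t[ g ->
  let G s := z + cintegral `]0, s[ g in
  let dH s := expi (a * s) * (g s + (0 +i* a) * G s) in
  cintegrable `]0, t[ dH /\ expi (a * t) * G t = z + cintegral `]0, t[ dH.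
Proof.
move=> t0 [igR igI] G dH.
have ccos : continuous (fun s : R => a * cos (a * s)).
  move=> s; apply: cvgM; first exact: cvg_cst.
  apply: continuous_cvg; first exact: continuous_cos.
  by apply: cvgM; [exact: cvg_cst|exact: cvg_id].
have csin : continuous (fun s : R => - a * sin (a * s)).
  move=> s; apply: cvgM; first exact: cvg_cst.
  apply: continuous_cvg; first exact: continuous_sin.
  by apply: cvgM; [exact: cvg_cst|exact: cvg_id].
have cosP h h0 := @by_parts_primitive R (fun s => cos (a * s)) _
  (is_derive_cosM a) csin h h0 t (fun x => cos_max _) t0.
have sinP h h0 := @by_parts_primitive R (fun s => sin (a * s)) _
  (is_derive_sinM a) ccos h h0 t (fun x => sin_max _) t0.
have [iRc eRc] := cosP _ (complex.Re z) igR.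
have [iIc eIc] := cosP _ (complex.Im z) igI.
have [iRs eRs] := sinP _ (complex.Re z) igR.
have [iIs eIs] := sinP _ (complex.Im z) igI.
rewrite mulr0 cos0 in eRc eIc; rewrite mulr0 sin0 in eRs eIs.
have mD : measurable (`]0, t[%classic : set R) by exact: measurable_itv.
have iR := @integrableB_EFin _ _ _ mu _ mD _ _ iRc iIs.
have iI := @integrableD_EFin _ _ _ mu _ mD _ _ iIc iRs.
split.
  split; [apply: eq_integrable iR|apply: eq_integrable iI] => // s _ /=; congr EFin.
    by rewrite /dH Re_mulc !Re_addc !Im_addc Re_mulc Im_mulc /G/= Re_addc Im_addc /=; ring.
  by rewrite /dH Im_mulc !Re_addc !Im_addc Re_mulc Im_mulc /G/= Re_addc Im_addc /=; ring.
apply: complex_eq.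
  rewrite Re_mulc !Re_addc !Im_addc !Re_cintegral !Im_cintegral Re_expi Im_expi.
  rewrite eRc eIs mul1r mul0r add0r -addrA -RintegralB//; congr (_ + _).
  apply: eq_Rintegral => s _.
  by rewrite /dH Re_mulc !Re_addc !Im_addc Re_mulc Im_mulc /G/= Re_addc Im_addc /=; ring.
rewrite Im_mulc !Re_addc !Im_addc !Re_cintegral !Im_cintegral Re_expi Im_expi.
rewrite eIc eRs mul1r mul0r add0r -addrA -RintegralD//; congr (_ + _).
apply: eq_Rintegral => s _.
by rewrite /dH Im_mulc !Re_addc !Im_addc Re_mulc Im_mulc /G/= Re_addc Im_addc /=; ring.
Qed.

End ComplexIntegral.

(** * Solutions of the control system *)

Section Solutions.
Context {R : realType} (omega_lo omega_hi : R).
Notation band := (band omega_lo omega_hi).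
Implicit Types (w : R -> R[i]) (Z : R -> band -> R[i]).

Definition duhamel w (Z0 : band -> R[i]) (t : R) (omega : band) : R[i] :=
  expi (val omega * t) *
  (Z0 omega - cintegral `]0, t[ (fun s => w s * expi (- (val omega * s)))).

Lemma cintegrable_expiN (D : set R) w (a : R) : measurable D ->
  cintegrable D w -> cintegrable D (fun s => w s * expi (- (a * s))).
Proof.
move=> mD iw; apply: (cintegrable_expi mD _ iw).
by apply: measurableT_comp => //; exact: measurable_mull.
Qed.

(** A general [J] covers both finite-time and asymptotic control. *)
Lemma is_solutionP (J : set R) w (Z0 : band -> R[i]) Z :
  (forall t, J t -> [/\ 0 <= t, L1 `]0, t[ w & forall s, 0 < s < t -> J s]) ->
  is_solution J w Z0 Z <->
  forall (omega : band) t, J t -> Z t omega = duhamel w Z0 t omega.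
Proof.
move=> JP; split => [solZ omega t Jt|ZE omega t Jt].
  have [t0 iw Js] := JP _ Jt; have [irhs Zt] := solZ omega t Jt.
  set a := val omega in irhs Zt *.
  have [_] := expi_primitive (- a) (Z0 omega) t0 irhs.
  rewrite -Zt => eZ.
  rewrite -[LHS](expiK (a * t)) -mulNr eZ; congr (_ * (_ + _)).
  rewrite -cintegralN//; last exact: cintegrable_expiN.
  apply: eq_cintegral => s; rewrite inE /= in_itv/= => st.
  have [_ Zs] := solZ omega s (Js _ st); rewrite -/a in Zs.
  rewrite -Zs mulNr.
  have -> : (0 +i* - a) = - (0 +i* a) :> R[i] by apply: complex_eq; rewrite /= ?oppr0.
  by ring.
have [t0 iw Js] := JP _ Jt; set a := val omega.
pose g s := - (w s * expi (- (a * s))).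
have ig s : J s -> cintegrable `]0, s[ g.
  by move=> /JP[_ iws _]; apply: cintegrableN => //; exact: cintegrable_expiN.
have ZG s : J s -> Z s omega = expi (a * s) * (Z0 omega + cintegral `]0, s[ g).
  move=> Jss; rewrite (ZE _ _ Jss) /duhamel; congr (_ * (_ + _)).
  rewrite -cintegralN//; apply: cintegrable_expiN => //.
  by case: (JP _ Jss).
have [iH eH] := expi_primitive a (Z0 omega) t0 (ig t Jt).
have rhsE : {in `]0, t[%classic, (fun s => expi (a * s) *
    (g s + (0 +i* a) * (Z0 omega + cintegral `]0, s[ g))) =1
    (fun s => (0 +i* a) * Z s omega - w s)}.
  move=> s; rewrite inE /= in_itv/= => st; rewrite (ZG _ (Js _ st)).
  by rewrite mulrDr /g mulrN (mulrC (w s)) expiK addrC mulrCA.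
split; first exact: eq_cintegrable iH.
by rewrite (ZG _ Jt) eH (eq_cintegral rhsE).
Qed.

End Solutions.

(** * Fourier transforms on the half line and asymptotic control *)

Section ComplexNorm.
Context {R : realType}.
Implicit Types (z : R[i]) (e : R).

Lemma norm_expi (x : R) : `|expi x| = 1.
Proof. by rewrite normc_def /expi/= cos2Dsin2 sqrtr1. Qed.

Lemma normc_le2 z e : `|complex.Re z| <= e -> `|complex.Im z| <= e ->
  `|z| <= (2 * e)%:C.
Proof.
move=> ze1 ze2; have e0 : 0 <= e by exact: le_trans ze1.
rewrite normc_def lecR -[leRHS]ger0_norm ?mulr_ge0// -sqrtr_sqr ler_wsqrtr//.
have h x : `|x| <= e -> x ^+ 2 <= e ^+ 2.
  by move=> xe; rewrite -real_normK ?num_real// lerXn2r ?nnegrE.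
have := h _ ze1; have := h _ ze2; have := sqr_ge0 e; rewrite exprMn; lra.
Qed.

Lemma normc_ltP z e : `|z| < e%:C -> `|complex.Re z| < e /\ `|complex.Im z| < e.
Proof.
rewrite normc_def ltcR => ze.
by split; apply: le_lt_trans ze; rewrite -sqrtr_sqr ler_wsqrtr// ?lerDl ?lerDr sqr_ge0.
Qed.

End ComplexNorm.

Section HalfLine.
Context {R : realType}.
Notation mu := (@lebesgue_measure R).
Notation D := (`]0%R, +oo[%classic : set R).
Implicit Types (u p : R -> R) (w v : R -> R[i]).

Let mD : measurable D. Proof. exact: measurable_itv. Qed.

Definition tail p (t : R) : R := \int[mu]_(x in D) (p x * (t <= x)%R%:R).

Let m_indic (t : R) : measurable_fun D (fun x : R => (t <= x)%R%:R : R).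
Proof. by apply: measurableT_comp => //; apply: measurable_fun_ler. Qed.

Let indic_le1 (t x : R) : `|((t <= x)%R%:R : R)| <= 1.
Proof. by case: (t <= x)%R; rewrite ?normr1 ?normr0. Qed.

Lemma tail_lt p (e : R) : (forall x, 0 <= p x) -> mu.-integrable D (EFin \o p) ->
  0 < e -> \forall t \near +oo, tail p t < e.
Proof.
move=> p0 ip e0.
have tail_nat : tail p n%:R @[n --> \oo] --> (0 : R).
  rewrite (_ : 0 = \int[mu]_(x in D) (p x * 0)); last first.
    by under eq_Rintegral do rewrite mulr0; rewrite Rintegral_cst// mul0r.
  apply: (@cvg_RintegralM _ _ _ mu D mD _ _ _ 1 ip (fun n => m_indic n%:R)
    (fun n x _ => indic_le1 n%:R x)) => x _.
  apply: cvg_near_cst; exists (Num.trunc x).+1 => // n /= xn.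
  apply/eqP; rewrite pnatr_eq0 eqb0 -ltNge (lt_le_trans (truncnS_gt _))//.
  by rewrite ler_nat.
have [n _ /(_ n (leqnn n)) /= ne] := (cvgrPdist_lt _ _).1 tail_nat e e0.
exists n%:R; split; first exact: num_real.
move=> t nt; rewrite sub0r normrN in ne.
apply: le_lt_trans (le_lt_trans (ler_norm _) ne).
have iip (r : R) := @integrableM_bounded _ _ _ mu D mD p _ 1 ip (m_indic r)
  (fun x _ => indic_le1 r x).
apply: le_Rintegral => //; [exact: iip..|].
move=> x _; rewrite ler_wpM2l// ler_nat.
by case: (leP t x) => // /(le_trans (ltW nt)) ->.
Qed.

Lemma dist_Rintegral_le_tail u p (t : R) : 0 < t ->
  mu.-integrable D (EFin \o u) -> mu.-integrable D (EFin \o p) ->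
  (forall x, `|u x| <= p x) ->
  `|\int[mu]_(x in D) u x - \int[mu]_(x in `]0, t[) u x| <= tail p t.
Proof.
move=> t0 iu ip up.
have iu_t := @integrableM_bounded _ _ _ mu D mD u _ 1 iu (m_indic t) (fun x _ => indic_le1 t x).
have ip_t := @integrableM_bounded _ _ _ mu D mD p _ 1 ip (m_indic t) (fun x _ => indic_le1 t x).
have iur : mu.-integrable D (EFin \o (u \_ `]0, t[)).
  rewrite -restrict_EFin; apply/integrable_restrict => //.
  apply: integrableS iu; [exact: mD| |by move=> x []].
  by apply: measurableI; exact: measurable_itv.
have -> : \int[mu]_(x in `]0, t[) u x = \int[mu]_(x in D) (u \_ `]0, t[) x.
  rewrite -Rintegral_mkcondr; congr Rintegral.
  apply/seteqP; split => x /=; last by case.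
  by rewrite !in_itv/= andbT => /andP[-> ->].
rewrite -RintegralB//.
rewrite (_ : \int[mu]_(x in D) _ = \int[mu]_(x in D) (u x * (t <= x)%R%:R)); last first.
  apply: eq_Rintegral => x; rewrite inE /= in_itv/= andbT => x0.
  rewrite patchE mem_setE in_itv/= x0/=.
  by case: ltP => _; rewrite ?subrr ?mulr0 ?subr0 ?mulr1.
apply: (le_trans (le_normr_Rintegral _ iu_t)) => //.
apply: le_Rintegral => //; first exact: (integrable_norm iu_t).
by move=> x _; rewrite normrM [`|_%:R|]ger0_norm// ler_wpM2r.
Qed.

(** Dominates the real and imaginary parts of [w x * z] for every [z] of
    modulus 1. *)
Definition abs1 w (x : R) : R := `|complex.Re (w x)| + `|complex.Im (w x)|.

Lemma integrable_abs1 w : L1 D w -> mu.-integrable D (EFin \o abs1 w).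
Proof.
by move=> [wR wI]; apply: integrableD_EFin => //; exact: (integrable_norm _).
Qed.

(** The truncation error does not depend on the frequency [a], whence the
    uniformity over the band. *)
Lemma dist_cintegral_le_tail w (a t : R) : 0 < t -> L1 D w ->
  let we s := w s * expi (- (a * s)) in
  let d := cintegral D we - cintegral `]0, t[ we in
  `|complex.Re d| <= tail (abs1 w) t /\ `|complex.Im d| <= tail (abs1 w) t.
Proof.
move=> t0 iw we d; have [iR iI] := cintegrable_expiN a mD iw.
have leM (x y c : R) : `|c| <= 1 -> `|x * c| <= `|x|.
  by move=> c1; rewrite normrM ler_piMr.
have -> : complex.Re d = \int[mu]_(x in D) complex.Re (we x) -
    \int[mu]_(x in `]0, t[) complex.Re (we x) by [].
have -> : complex.Im d = \int[mu]_(x in D) complex.Im (we x) -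
    \int[mu]_(x in `]0, t[) complex.Im (we x) by [].
split; apply: dist_Rintegral_le_tail => //; try exact: integrable_abs1.
  move=> x; rewrite /we Re_mulc /abs1 (le_trans (ler_normB _ _))// lerD// leM//.
    exact: cos_max.
  exact: sin_max.
move=> x; rewrite /we Im_mulc /abs1 (le_trans (ler_normD _ _))// lerD// leM//.
  exact: sin_max.
exact: cos_max.
Qed.

End HalfLine.

Section Fourier.
Context {R : realType}.
Notation mu := (@lebesgue_measure R).
Notation D := (`]0%R, +oo[%classic : set R).
Implicit Types (w v : R -> R[i]).

Lemma fourier_extend0 (I : set R) w (a : R) :
  fourier (extend0 I w) a = cintegral I (fun t => w t * expi (- (a * t))).
Proof.
apply: complex_eq; rewrite !(Re_cintegral, Im_cintegral) [RHS]Rintegral_mkcond.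
  by apply: eq_Rintegral => t _; rewrite /extend0 /patch; case: ifPn => // _; rewrite mul0r.
by apply: eq_Rintegral => t _; rewrite /extend0 /patch; case: ifPn => // _; rewrite mul0r.
Qed.

Lemma fourier_bandE omega_lo omega_hi (I : set R) w (omega : band omega_lo omega_hi) :
  fourier_band I w omega =
  cintegral I (fun t => w t * expi (- (val omega * t))).
Proof. exact: fourier_extend0. Qed.

(** [gap_ae0] applies to the real and imaginary parts of
    [(w t - v t) * exp (- i c t)], where [c] is the midpoint of the band: the
    transforms at [a] and [- a] together separate the two parts. *)
Lemma fourier_band_inj omega_lo omega_hi w v : omega_lo < omega_hi ->
  L1 D w -> L1 D v ->
  fourier_band (omega_lo := omega_lo) (omega_hi := omega_hi) D w = fourier_band D v ->
  ae_eq_on D w v.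
Proof.
move=> lohi iw iv wv.
have mD : measurable D by exact: measurable_itv.
pose c : R := (omega_lo + omega_hi) / 2; pose delta : R := (omega_hi - omega_lo) / 2.
have d0 : 0 < delta by rewrite divr_gt0 ?subr_gt0.
pose d t := (w t - v t) * expi (- (c * t)).
have id : cintegrable D d.
  by apply: cintegrable_expiN => //; apply: cintegrableD => //; exact: cintegrableN.
have dhat0 (a : R) : `|a| < delta -> cintegral D (fun t => d t * expi (- (a * t))) = 0.
  move=> ad; have caP : `]omega_lo, omega_hi[%classic (c + a).
    by rewrite /= in_itv/=; move: ad; rewrite ltr_norml /delta /c; lra.
  pose ca : band omega_lo omega_hi := SigSub (mem_set caP).
  have := congr1 (fun f => f ca) wv; rewrite !fourier_bandE /= => /eqP.
  have iwe := cintegrable_expiN (c + a) mD iw.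
  have ive := cintegrable_expiN (c + a) mD iv.
  rewrite -subr_eq0 -(cintegralN mD ive).
  rewrite -(cintegralD mD iwe (cintegrableN mD ive)).
  move=> /eqP <-; apply: eq_cintegral => t _.
  by rewrite /d -mulrA -expiD -opprD -mulrDl mulrBl.
pose u t := complex.Re (d t); pose y t := complex.Im (d t).
have [iu iy] : mu.-integrable D (EFin \o u) /\ mu.-integrable D (EFin \o y) := id.
have iM f (g : R -> R) (a : R) : mu.-integrable D (EFin \o f) -> continuous g ->
    (forall x, `|g x| <= 1) -> mu.-integrable D (EFin \o (fun t => f t * g (a * t))).
  move=> if_ cg g1; apply: (@integrableM_bounded _ _ _ mu D mD _ _ 1) => //.
  apply: measurableT_comp; last exact: measurable_mull.
  exact: continuous_measurable_fun.
pose C f (a : R) := \int[mu]_(t in D) (f t * cos (a * t)).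
pose S f (a : R) := \int[mu]_(t in D) (f t * sin (a * t)).
have CN f a : C f (- a) = C f a.
  by apply: eq_Rintegral => t _; rewrite mulNr cosN.
have SN f a : mu.-integrable D (EFin \o f) -> S f (- a) = - S f a.
  move=> if_; rewrite /S -[RHS]mulN1r -RintegralZl//; last exact: (iM _ _ _ if_ (@continuous_sin R) (@sin_max R)).
  by apply: eq_Rintegral => t _; rewrite mulNr sinN mulN1r mulrN.
have ReE (a : R) : `|a| < delta -> C u a + S y a = 0.
  move=> /dhat0 /(congr1 (@complex.Re R)); apply: etrans.
  rewrite Re_cintegral /C /S -RintegralD//; last 2 first.
  - exact: (iM _ _ _ iu (@continuous_cos R) (@cos_max R)).
  - exact: (iM _ _ _ iy (@continuous_sin R) (@sin_max R)).
  by apply: eq_Rintegral => t _; rewrite Re_mulc Re_expi Im_expi cosN sinN mulrN opprK.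
have ImE (a : R) : `|a| < delta -> C y a - S u a = 0.
  move=> /dhat0 /(congr1 (@complex.Im R)); apply: etrans.
  rewrite Im_cintegral /C /S -RintegralB//; last 2 first.
  - exact: (iM _ _ _ iy (@continuous_cos R) (@cos_max R)).
  - exact: (iM _ _ _ iu (@continuous_sin R) (@sin_max R)).
  by apply: eq_Rintegral => t _; rewrite Im_mulc Re_expi Im_expi cosN sinN mulrN addrC.
have hN (a : R) : `|a| < delta -> `|- a| < delta by rewrite normrN.
have u0 : {ae mu, forall t, D t -> u t = 0}.
  apply: (gap_ae0 iu d0) => a ad; have := ReE _ ad; have := ReE _ (hN _ ad);
    have := ImE _ ad; have := ImE _ (hN _ ad); rewrite !CN !SN// /C /S; lra.
have y0 : {ae mu, forall t, D t -> y t = 0}.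
  apply: (gap_ae0 iy d0) => a ad; have := ReE _ ad; have := ReE _ (hN _ ad);
    have := ImE _ ad; have := ImE _ (hN _ ad); rewrite !CN !SN// /C /S; lra.
move: u0 y0; apply: filterS2; first exact: (ae_filter_ringOfSetsType mu).
move=> t ut yt Dt; apply/eqP; rewrite -subr_eq0; apply/eqP.
rewrite -[LHS](expiK (c * t)) [expi (- _) * _]mulrC -/(d t).
by rewrite (_ : d t = 0) ?mulr0//; apply: complex_eq; [exact: ut|exact: yt].
Qed.

End Fourier.

Section Controllability.
Context {R : realType} (omega_lo omega_hi : R).
Notation band := (band omega_lo omega_hi).
Notation D := (`]0%R, +oo[%classic : set R).

(** The modulus of [duhamel w Z0 t] is that of [Z0 - int_0^t w E], where [E] is
    the conjugate exponential; its limit is 0 exactly when [Z0] is the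
    transform. *)
Lemma steers_to0P (w : R -> R[i]) (Z0 : band -> R[i]) : L1 D w ->
  steers_to0 w Z0 <-> fourier_band D w = Z0.
Proof.
move=> iw; have mD : measurable D by exact: measurable_itv.
have JP t : (`[0%R, +oo[%classic : set R) t ->
    [/\ 0 <= t, L1 `]0, t[ w & forall s, 0 < s < t -> (`[0%R, +oo[%classic : set R) s].
  rewrite /= in_itv/= andbT => t0; split => //; last first.
    by move=> s /andP[s0 _]; rewrite in_itv/= andbT ltW.
  have sD : `]0, t[%classic `<=` D.
    by move=> x; rewrite /= !in_itv/= andbT => /andP[].
  by case: iw => wR wI; split; [apply: integrableS wR|apply: integrableS wI];
    rewrite //; exact: measurable_itv.
pose Ft t (omega : band) :=
  cintegral `]0, t[ (fun s => w s * expi (- (val omega * s))).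
have p0 x : 0 <= abs1 w x by rewrite addr_ge0.
have tail_lt_e e e0 := tail_lt p0 (integrable_abs1 iw) (e := e) e0.
split => [[Z [/(is_solutionP _ _ JP) ZE Zc]]|<-].
  apply/funext => omega; rewrite fourier_bandE; apply/eqP; rewrite -subr_eq0.
  set F := cintegral D _.
  suff small (e : R) : 0 < e ->
      `|complex.Re (F - Z0 omega)| <= e /\ `|complex.Im (F - Z0 omega)| <= e.
    have zero (x : R) : (forall e, 0 < e -> `|x| <= e) -> x = 0.
      move=> xe; apply/eqP; rewrite -normr_le0; apply/ler_addgt0Pl => e e0.
      by rewrite addr0; exact: xe.
    by apply/eqP; apply: complex_eq; apply: zero => e /small[].
  move=> e0; have e2 : 0 < e / 2 by rewrite divr_gt0.
  have [t [t0 tt /(_ omega) Zt]] : exists t, [/\ 0 < t, tail (abs1 w) t < e / 2 &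
      forall omega : band, `|Z t omega| < (e / 2)%:C].
    near (+oo : set_system R) => t; exists t; split => //; near: t.
    - exact: tail_lt_e.
    - exact: Zc.
  have {Zt} : `|Z0 omega - Ft t omega| < (e / 2)%:C.
    move: Zt; rewrite ZE; last by rewrite /= in_itv/= andbT ltW.
    by rewrite /duhamel normrM norm_expi mul1r.
  move=> /normc_ltP[reZ imZ].
  have [reF imF] := dist_cintegral_le_tail (val omega) t0 iw.
  rewrite (_ : F - Z0 omega = (F - Ft t omega) - (Z0 omega - Ft t omega)); last by ring.
  have ReB (x y : R[i]) : complex.Re (x - y) = complex.Re x - complex.Re y by case: x; case: y.
  have ImB (x y : R[i]) : complex.Im (x - y) = complex.Im x - complex.Im y by case: x; case: y.
  split.
    rewrite ReB (le_trans (ler_normB _ _))//.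
    by move: reF; rewrite -/F -/(Ft t omega); lra.
  rewrite ImB (le_trans (ler_normB _ _))//.
  by move: imF; rewrite -/F -/(Ft t omega); lra.
exists (duhamel w (fourier_band D w)); split; first exact/is_solutionP.
move=> e e0; have e3 : 0 < e / 3 by rewrite divr_gt0.
near=> t => omega.
have t0 : 0 < t by near: t; by exists 0; split; [rewrite real0|move=> x x0].
have tt : tail (abs1 w) t < e / 3 by near: t; exact: tail_lt_e.
rewrite /duhamel normrM norm_expi mul1r fourier_bandE.
have [reF imF] := dist_cintegral_le_tail (val omega) t0 iw.
apply: le_lt_trans (normc_le2 (le_trans reF (ltW tt)) (le_trans imF (ltW tt))) _.
by rewrite ltcR; lra.
Unshelve. all: by end_near. Qed.

End Controllability.

(** * Reachability in finite time *)

Section Translation.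
Context {R : realType} (T : R).
Notation mu := (@lebesgue_measure R).

Lemma lebesgue_measure_shift (A : set R) : measurable A ->
  pushforward mu ((fun x => x + T) : _ -> measurableTypeR R) A = mu A.
Proof.
move=> mA; apply/esym/lebesgue_measure_unique => //=.
  exact: measurable_funD.
move=> _ _ [[a b]] _ <-.
rewrite /pushforward.
rewrite (_ : _ @^-1` _ = `](a - T), (b - T)]%classic); last first.
  by apply/predeqP => x; rewrite /preimage/= !in_itv/= ltrBlDr lerBrDr.
by rewrite /= !lebesgue_measure_itv/= !lte_fin ltrD2r -!EFinB opprB addrA subrK.
Qed.

Lemma integral_shift (g : R -> R) : mu.-integrable setT (EFin \o g) ->
  mu.-integrable setT (EFin \o (fun x => g (x + T))) /\
  \int[mu]_x g (x + T) = \int[mu]_x g x.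
Proof.
move=> ig.
have mg : measurable_fun setT (EFin \o g) := measurable_int _ ig.
have mshift : measurable_fun setT ((fun x => x + T) : measurableTypeR R -> measurableTypeR R).
  exact: measurable_funD.
have igT : mu.-integrable setT (EFin \o (fun x => g (x + T))).
  apply/integrableP; split; first exact: (measurableT_comp mg mshift).
  move/integrableP : ig => [_]; apply: le_lt_trans.
  have := @ge0_integral_pushforward _ _ _ _ R _ mshift mu setT (abse \o (EFin \o g)).
  have mabs : measurable_fun setT (abse \o (EFin \o g)) by exact: measurableT_comp.
  rewrite preimage_setT => /(_ measurableT mabs (fun y _ => abse_ge0 _)) <-.
  by rewrite (eq_measure_integral mu)// => A mA _; exact: lebesgue_measure_shift.
split => //; rewrite /Rintegral; congr fine.
have := @integral_pushforward _ _ _ _ R _ mshift mu setT (EFin \o g) mg.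
rewrite preimage_setT => /(_ igT measurableT) <-.
by apply: eq_measure_integral => A mA _; exact: lebesgue_measure_shift.
Qed.

Lemma Rintegral_shift (g : R -> R) (a b : R) : mu.-integrable `]a, b[ (EFin \o g) ->
  mu.-integrable `](a - T), (b - T)[ (EFin \o (fun x => g (x + T))) /\
  \int[mu]_(x in `](a - T), (b - T)[) g (x + T) = \int[mu]_(x in `]a, b[) g x.
Proof.
move=> ig; pose g0 := g \_ `]a, b[.
have ig0 : mu.-integrable setT (EFin \o g0).
  rewrite -restrict_EFin; apply: (integrable_mkcond _ _).1; last exact: ig.
  exact: measurable_itv.
have [igT eT] := integral_shift ig0.
have shiftE : (fun x => g0 (x + T)) = (fun x => g (x + T)) \_ `](a - T), (b - T)[.
  by apply/funext => x; rewrite /g0 !patchE !mem_setE !in_itv/= ltrBlDr ltrBrDr.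
rewrite shiftE in igT eT; split.
  apply: (integrable_mkcond _ _).2; first exact: measurable_itv.
  by rewrite restrict_EFin.
by rewrite Rintegral_mkcond eT /g0 -Rintegral_mkcond.
Qed.

Lemma cintegral_shift (g : R -> R[i]) (a b : R) : cintegrable `]a, b[ g ->
  cintegrable `](a - T), (b - T)[ (fun x => g (x + T)) /\
  cintegral `](a - T), (b - T)[ (fun x => g (x + T)) = cintegral `]a, b[ g.
Proof.
move=> [/Rintegral_shift[iR eR] /Rintegral_shift[iI eI]]; split => //.
by apply: complex_eq; [exact: eR|exact: eI].
Qed.

End Translation.

Section Reachability.
Context {R : realType} (omega_lo omega_hi T : R).
Hypothesis T_gt0 : 0 < T.
Notation band := (band omega_lo omega_hi).

Lemma L1_shift (w : R -> R[i]) (a b t : R) : L1 `]a, b[ w ->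
  L1 `](a - t), (b - t)[ (fun x => - w (x + t)).
Proof.
move=> iw; apply: cintegrableN; first exact: measurable_itv.
by have [] := cintegral_shift t iw.
Qed.

(** Substituting [s = x + T] in
    [- exp (i omega T) int_0^T w s exp (- i omega s)] absorbs the prefactor. *)
Lemma duhamel_fourier (w : R -> R[i]) : L1 `]0, T[ w ->
  duhamel w (fun=> 0 : R[i]) T =
  fourier_band (omega_lo := omega_lo) (omega_hi := omega_hi) `]- T, 0[
    (fun x => - w (x + T)).
Proof.
move=> iw; apply/funext => omega; rewrite /duhamel fourier_bandE sub0r.
have mD : measurable (`]0, T[%classic : set R) by exact: measurable_itv.
pose a := val omega.
pose g s := - expi (a * T) * (w s * expi (- (a * s))).
have iwe := cintegrable_expiN a mD iw.
have [_ eT] := cintegral_shift T (cintegrableZ mD (- expi (a * T)) iwe).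
rewrite sub0r subrr in eT.
transitivity (cintegral `]0, T[ g); first by rewrite /g cintegralZ// mulrN mulNr.
rewrite /g -eT; apply: eq_cintegral => s _ /=.
rewrite mulrCA mulNr mulrN -mulNr; congr (_ * _).
by rewrite -expiD; congr expi; rewrite -/a; ring.
Qed.

Lemma reachable_fourier :
  reachable_from0 omega_lo omega_hi T = fourier_L1 omega_lo omega_hi `]- T, 0[.
Proof.
have JP w : L1 `]0, T[ w -> forall t : R, (`[0, T]%classic : set R) t ->
    [/\ 0 <= t, L1 `]0, t[ w & forall s : R, 0 < s < t -> (`[0, T]%classic : set R) s].
  move=> iw t; rewrite /= in_itv/= => /andP[t0 tT]; split => //; last first.
    by move=> s /andP[s0 st]; rewrite in_itv/= !ltW// (lt_le_trans st).
  have sub : (`]0, t[%classic : set R) `<=` `]0, T[%classic.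
    by apply: subset_itv; rewrite bnd_simp.
  by case: iw => wR wI; split; [apply: integrableS wR|apply: integrableS wI];
    rewrite //; exact: measurable_itv.
have TT : (`[0, T]%classic : set R) T by rewrite /= in_itv/= lexx ltW.
apply/seteqP; split => [ZT [w [iw [Z [solZ <-]]]]|_ [v iv <-]].
  exists (fun x => - w (x + T)); last first.
    rewrite -duhamel_fourier//; apply/funext => omega.
    by rewrite ((is_solutionP _ _ (JP _ iw)).1 solZ).
  by have := L1_shift T iw; rewrite sub0r subrr.
pose w x := - v (x - T).
have iw : L1 `]0, T[ w.
  by have := L1_shift (- T) iv; rewrite opprK addrC subrr add0r.
exists w; split => //; exists (duhamel w (fun=> 0)); split.
  exact/(is_solutionP _ _ (JP _ iw)).
rewrite duhamel_fourier//; congr fourier_band.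
by apply/funext => x; rewrite /w opprK addrK.
Qed.

End Reachability.

Local Close Scope complex_scope.

Theorem proposition1 (R : realType) (omega_lo omega_hi T : R)
  (lt_omega : omega_lo < omega_hi) (T_gt0 : 0 < T) :
  [/\ reachable_from0 omega_lo omega_hi T =
        fourier_L1 omega_lo omega_hi `]- T, 0[,
      asymptotically_zero_controllable omega_lo omega_hi =
        fourier_L1 omega_lo omega_hi `]0, +oo[
    & forall Z0 : band omega_lo omega_hi -> R[i],
        fourier_L1 omega_lo omega_hi `]0, +oo[ Z0 ->
        exists w : R -> R[i],
          (* w = F^-1[Z0] *)
          unique_L1 `]0, +oo[ (fun v => fourier_band `]0, +oo[ v = Z0) w /\
          unique_L1 `]0, +oo[ (fun v => steers_to0 v Z0) w].
Proof.
split.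
- exact: reachable_fourier.
- apply/seteqP; split => [Z0 [w [iw /steers_to0P -/(_ iw) <-]]|_ [w iw <-]].
    by exists w.
  by exists w; split => //; exact/steers_to0P.
move=> _ [w iw <-]; exists w; split; split => //.
- by move=> v iv; exact: fourier_band_inj.
- exact/steers_to0P.
- by move=> v iv /steers_to0P -/(_ iv); exact: fourier_band_inj.
Qed.
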